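(* Let $p\equiv 3\pmod{4}$ be a prime power. Then there exists an elementary $(\mathbb{F}_{p}^+ \times \mathbb{F}_{q}^+,\mathbb{F}_{p}^+\times \{0\},p+1,1)$-FDF for any prime power $q\equiv 1 \pmod{p+1}$ with $q>Q((p+1)/2,p)$.
   Context: Unions of (multi)sets are multiset unions, and $\underline{h}A$ denotes the multiset union of $h$ copies of $A$. $\mathbb{F}_q^+$ is the additive group of the finite field $\mathbb{F}_q$. For positive integers $d,m$, $$Q(d,m)=\tfrac14\left(U+\sqrt{U^2+4d^{m-1}m}\right)^2,\qquad U=\sum_{h=1}^m \binom{m}{h}(d-1)^h(h-1).$$ Frame difference family: let $H$ be a finite abelian group with a subgroup $N$ of order $n$. An $(H,N,k,\lambda)$-DF (relative difference family) is a family $\mathfrak{B}=[B_1,\dots,B_r]$ of $k$-subsets of $H$ (base blocks) such that the multiset $\bigcup_{i=1}^r[x-y:x,y\in B_i,\ x\neq y]$ equals $\underline{\lambda}(H\setminus N)$. It is an $(H,N,k,\lambda)$-FDF if it can be partitioned into $\lambda n/(k-1)$ subfamilies, each consisting of $(|H|-n)/(nk)$ base blocks, such that the union of the base blocks in each subfamily is a system of representatives for the nontrivial cosets of $N$ in $H$. The FDF is elementary if $\lambda n=k-1$. *)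

(* Defs.v *)
From HB Require Import structures.
From mathcomp Require Import all_boot all_order all_algebra.

Set Implicit Arguments.
Unset Strict Implicit.
Unset Printing Implicit Defensive.

Import Order.TTheory GRing.Theory Num.Theory.
Local Open Scope ring_scope.

(* The library has the zmodType and finType structures on products, but not
   their join. *)
HB.instance Definition _ (U V : finZmodType) := GRing.Zmodule.on (U * V)%type.

Definition prime_power (q : nat) : Prop :=
  exists r e : nat, [/\ prime r, (0 < e)%N & q = (r ^ e)%N].

(* The predecessors below are ordinary subtraction for d, m, h >= 1, which is
   the only range in which these quantities are used. *)
Definition U_bound (d m : nat) : nat :=
  (\sum_(1 <= h < m.+1) 'C(m, h) * d.-1 ^ h * h.-1)%N.

Definition Q_bound (R : rcfType) (d m : nat) : R :=
  let U := (U_bound d m)%:R in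
  4%:R^-1 * (U + Num.sqrt (U ^+ 2 + 4%:R * d%:R ^+ m.-1 * m%:R)) ^+ 2.

(* Multisets are sequences up to perm_eq: a multiset union is a concatenation,
   and a family of blocks is a sequence of sets.  The ambient abelian group is
   a whole finZmodType V, and a subgroup is a set N satisfying zmod_closed. *)
Section DifferenceFamilies.

Variable V : finZmodType.
Implicit Types (N B : {set V}) (s : seq V) (Bs : seq {set V}).

Definition block_differences B : seq V :=
  [seq x - y | x <- enum B, y <- enum (B :\ x)].

Definition is_DF N (k lambda : nat) Bs : Prop :=
  [/\ zmod_closed N,
      {in Bs, forall B, #|B| = k}
    & perm_eq (flatten [seq block_differences B | B <- Bs])
              (flatten (nseq lambda (enum (~: N))))].

Definition add_coset N (x : V) : {set V} := [set x + y | y in N].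

Definition nontrivial_cosets N : {set {set V}} :=
  [set add_coset N x | x in [set: V]] :\ N.

(* Multiplicities count: each nontrivial coset is represented exactly once,
   and no member of s lies in N. *)
Definition nontrivial_coset_representatives N s : Prop :=
  perm_eq [seq add_coset N x | x <- s] (enum (nontrivial_cosets N)).

(* The numbers lambda n / (k - 1) of subfamilies and (|V| - n) / (n k) of
   blocks in each are given by products, so that both divisions (for k > 1)
   are required to be exact. *)
Definition is_FDF N (k lambda : nat) Bs : Prop :=
  is_DF N k lambda Bs /\
  exists P : seq (seq {set V}),
    [/\ perm_eq (flatten P) Bs,
        (size P * (k - 1) = lambda * #|N|)%N
      & {in P, forall S : seq {set V},
          (size S * (#|N| * k) = #|V| - #|N|)%N /\
          nontrivial_coset_representatives N
            (flatten [seq enum B | B : {set V} <- S])}].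

Definition is_elementary_FDF N (k lambda : nat) Bs : Prop :=
  is_FDF N k lambda Bs /\ (lambda * #|N| = k - 1)%N.

End DifferenceFamilies.

(* Main.v *)
Require Import Defs.
From HB Require Import structures.
From mathcomp Require Import all_boot all_order all_algebra all_field.
From mathcomp Require Import cyclic.
From mathcomp Require Import zify ring.

Set Implicit Arguments.
Unset Strict Implicit.
Unset Printing Implicit Defensive.

Import Order.TTheory GRing.Theory Num.Theory.
Local Open Scope ring_scope.

(** Put [p = #|Fp|], [e = (p + 1) / 2] and let [D] be the set of squares of [Fp],
    zero included; it has [e] elements.  Let [kappa z = z^((q-1)/e)] on [Fq], so
    that the cyclotomic classes of order [e] are the fibres of [kappa] on nonzero
    elements; as [p + 1] divides [q - 1], [kappa (-1) = 1].  The base blocks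
    consist of all [(s, t y_s)] and [(s, - t y_s)] with [s] in [D], one block for
    each [t] in a set of representatives, up to sign, of the kernel of [kappa].

    The second coordinates of the blocks are the [+- t y_s]: they run through the
    nonzero elements of [Fq] once each if the [y_s] represent the [e] classes.
    The differences with first coordinate 0 are the [+- 2 t y_s], so they are
    covered too.  Those with first coordinate [d <> 0] are the
    [+- t (y_s - y_s')] and [+- t (y_s + y_s')] with [s - s' = d].  Because
    [p = 3 mod 4], [D] has [e / 2] pairs with difference [d], and [d] or [- d] is
    a square; so there are [e] values [y_s - y_s'], [y_s + y_s'] for each [d] up
    to sign, and it is enough that they represent all classes
    ([blocks_elementary_FDF]).

    The classes can therefore be distributed in advance, and the [y_s] chosen one
    after another ([paley_choice], [greedy_choice]).  Each step asks for an [x]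
    with at most [p = 2 e - 1] prescribed values [kappa (b - x)], at distinct
    [b].  When these conditions are expanded in characters, [q > Q(e, p)] is what
    makes the number of solutions positive ([cyclotomic_count]), given the Weil
    bound [(h - 1) sqrt q] for a sum over [x] of a product of nontrivial
    characters of [b_1 - x], ..., [b_h - x] ([weil_bound]).

    The Weil bound rests on two facts.  First, extend the product of characters
    to a multiplicative function of monic polynomials, and sum it over those of
    each degree [n].  The sum is 0 for [n >= h] because the values at the [b_i]
    can be prescribed by interpolation; so the generating function is a
    polynomial, a product of at most [h - 1] factors [1 - w X], and the
    character sum is minus the sum of the [w].  The Euler product and Newton's
    identities identify minus the sum of the [w^n] with the corresponding
    character sum over the field with [q^n] elements ([Lcoef_newton],
    [L_bound]).  Second, the character sums over the fields with [q^(2 k)]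
    elements are [O(q^k)], with an unspecified constant ([frob_sum_bound]).
    This forces [|w| <= sqrt q], which recovers the sharp constant.

    The second fact is Stepanov's method ([stepanov_bound]).  For [Q = q^(2 k)]
    and [f] the product of the [(b_i - X)^(a_i)], the points where
    [f^((Q-1)/e)] takes a given value are zeros of high order of a polynomial
    [\sum_(i, j) k_ij X^(j Q) f^(i (Q-1)/e)] found by linear algebra.  It is not
    zero because [Y^e - c / f] is irreducible over the rational functions
    ([kummer_no_small_annihilator]). *)

(** * Irreducibility of [f Y^e - c] *)

(** The companion matrix of [d] has [e]-th power [w], so [u] is its determinant. *)
Lemma dvdp_Xn_subC_norm (L : fieldType) (d : {poly L}) (e : nat) (w : L) :
  d \is monic -> (1 < size d)%N -> d %| 'X^e - w%:P ->
  exists u, u ^+ e = w ^+ (size d).-1.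
Proof.
move=> dmon ds dvd.
case Es: (size d).-1 => [|s]; first by move: ds; rewrite -ltnS; lia.
have [C charC]: exists C : 'M[L]_s.+1, char_poly C = d.
  have := companionmxK dmon; move: (companionmx d); rewrite Es => C HC.
  by exists C.
have CH := Cayley_Hamilton C; rewrite charC in CH.
have : horner_mx C ('X^e - w%:P) = 0.
  by case/dvdpP: dvd => qq ->; rewrite rmorphM /= CH mulr0.
rewrite rmorphB /= rmorphXn /= horner_mx_X horner_mx_C => /eqP.
rewrite subr_eq0 => /eqP CE.
exists (\det C); rewrite -(det_scalar s.+1 w) -CE.
elim: e {dvd CE} => [|e IH]; first by rewrite !expr0 det1.
by rewrite !exprS detM IH.
Qed.

Lemma mup_exp (K : fieldType) (x : K) (p : {poly K}) n :
  p != 0 -> mup x (p ^+ n) = (n * mup x p)%N.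
Proof.
move=> p0; elim: n => [|n IH]; first by rewrite expr0 mupNroot ?root1.
by rewrite exprS mupM ?expf_neq0 // IH mulSn.
Qed.

Lemma mup_polyC (K : fieldType) (x c : K) : c != 0 -> mup x c%:P = 0%N.
Proof. by move=> c0; rewrite mupNroot ?rootC. Qed.

Lemma frac_split (D : idomainType) (u : {fraction D}) :
  exists n d : D, d != 0 /\ u * FracField.tofrac d = FracField.tofrac n.
Proof.
elim/quotW: u => x.
exists (frac x).1, (frac x).2; split; first exact: denom_ratioP.
unlock FracField.tofrac.
rewrite !piE; apply/eqmodP; rewrite /= FracField.equivfE /mulf.
by rewrite !numden_Ratio ?mulf_neq0 ?oner_neq0 ?denom_ratioP // !mulr1 mulrC.
Qed.

Lemma ltn_pred_absurd a b n : (a < n.-1)%N -> (n <= b.+1)%N -> (b <= a)%N -> False.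
Proof. lia. Qed.

(** For [P] in [K[X][Y]] of degree less than [e] in [Y], the resultant of [P] and
    [f Y^e - c] is, up to sign and powers of [f], the norm of [P (Y)] from the extension
    of [K(X)] generated by an [e]-th root of [c / f].  It is a polynomial in [X]
    whose degree is controlled by those of the coefficients of [P], and it
    belongs to the ideal generated by [P] and [f Y^e - c]. *)

Section KummerNorm.

Variables (K : fieldType) (f : {poly K}) (c : K) (e : nat).
Hypotheses (f0 : f != 0) (c0 : c != 0) (e_gt0 : (0 < e)%N).
Hypothesis fe : forall s, (0 < s < e)%N -> exists b, ~~ (e %| s * mup b f)%N.

Let G : {poly {poly K}} := f *: 'X^e - c%:P%:P.

Lemma size_kummer : size G = e.+1.
Proof.
rewrite /G size_polyDl ?size_scale ?size_polyXn //.
by rewrite size_polyN ltnS (leq_trans (size_polyC_leq1 _)).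
Qed.

(** [Y^e - c / f] is irreducible over [K(X)]: a factor of degree [s] would make
    [(c / f)^s] an [e]-th power, so [e] would divide [s] times every multiplicity
    of [f], which hypothesis [fe] forbids for [0 < s < e]. *)
Lemma kummer_resultant_neq0 (P : {poly {poly K}}) :
  P != 0 -> (size P <= e)%N -> resultant P G != 0.
Proof.
move=> P0 sP; rewrite resultant_eq0; apply/negP => sg.
set d0 := gcdp P G in sg.
pose tf := @FracField.tofrac {poly K}.
have tfi : injective tf by move=> x y /eqP; rewrite tofrac_eq => /eqP.
pose d1 := map_poly tf d0.
have sd1 : size d1 = size d0.
  by apply: size_map_inj_poly => //; rewrite ?rmorph0.
have sdP : (size d0 <= e)%N.
  by apply: leq_trans sP; apply: dvdp_leq => //; apply: dvdp_gcdl.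
have d1G : d1 %| map_poly tf G.
  have /Pdiv.Idomain.dvdpP [[u q] /= u0 E] := dvdp_gcdr P G.
  have := congr1 (map_poly tf) E; rewrite rmorphM /= -/d0 -/d1 => E'.
  have : d1 %| map_poly tf (u *: G) by rewrite E' dvdp_mulIr.
  by rewrite map_polyZ /= dvdpZr // tofrac_eq0.
have tff0 : tf f != 0 by rewrite tofrac_eq0.
have d10 : d1 != 0 by rewrite -size_poly_gt0 sd1; lia.
pose w := tf c%:P / tf f.
have GE : map_poly tf G = tf f *: ('X^e - w%:P).
  rewrite /G rmorphB /= map_polyZ /= map_polyXn map_polyC /= scalerBr.
  by congr (_ - _); rewrite -mul_polyC -polyCM /w mulrC divfK.
pose d2 := (lead_coef d1)^-1 *: d1.
have lc0 : (lead_coef d1)^-1 != 0 by rewrite invr_eq0 lead_coef_eq0.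
have sd2 : size d2 = size d0 by rewrite size_scale // sd1.
have d2mon : d2 \is monic by rewrite monicE lead_coefZ mulVf ?lead_coef_eq0.
have d2d : d2 %| 'X^e - w%:P.
  by rewrite (dvdpZl _ _ lc0) -(dvdpZr _ _ tff0) -GE.
have sd2' : (1 < size d2)%N by rewrite sd2.
have [u] := dvdp_Xn_subC_norm d2mon sd2' d2d.
rewrite sd2; set s := (size d0).-1 => uE.
have s_lt : (0 < s < e)%N by rewrite /s; lia.
have [b /negP] := fe s_lt; apply.
have [n [d [dn0 ud]]] := frac_split u.
have nE : n ^+ e * f ^+ s = c%:P ^+ s * d ^+ e.
  have tfM : {morph tf : x y / x * y} by exact: tofracM.
  have tfX n' : {morph tf : x / x ^+ n'} by exact: tofracXn.
  apply: tfi; rewrite !tfM !tfX.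
  rewrite -[tf n]ud exprMn uE mulrAC -exprMn.
  by rewrite /w (divfK tff0).
have n0 : n != 0.
  apply: contra_eq_neq nE => ->.
  by rewrite expr0n eqn0Ngt e_gt0 mul0r eq_sym mulf_neq0 ?expf_neq0 ?polyC_eq0.
have := congr1 (mup b) nE.
rewrite !mupM ?expf_neq0 ?polyC_eq0 // !mup_exp ?polyC_eq0 // mup_polyC // muln0 add0n =>
  E.
have -> : (s * mup b f = e * mup b d - e * mup b n)%N by rewrite -E addKn.
by rewrite -mulnBr dvdn_mulr.
Qed.

Lemma size_kummer_resultant (P : {poly {poly K}}) D m :
  (1 < size P <= e)%N -> (forall i, (size (P`_i)%R <= D.+1)%N) -> (size f <= m.+1)%N ->
  (size (resultant P G) <= (e * D + e.-1 * m).+1)%N.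
Proof.
move=> /andP[P1 Pe] PD fm.
have GD i : (size (G`_i)%R <= m.+1)%N.
  rewrite /G coefB coefZ coefXn coefC.
  apply: leq_trans (size_polyD _ _) _; rewrite size_polyN geq_max; apply/andP; split.
    by case: (i == e); rewrite ?mulr1 ?mulr0 ?size_poly0.
  by case: (i == 0)%N; rewrite ?size_poly0 // (leq_trans (size_polyC_leq1 _)).
have dG : (size G).-1 = e by rewrite size_kummer.
rewrite /resultant /determinant.
apply: leq_trans (size_sum _ _ _) _; apply/bigmax_leqP => sg _.
have szsign (b : bool) (p : {poly K}) : size ((-1) ^+ b * p) = size p.
  by rewrite mulr_sign; case: b; rewrite ?size_polyN.
rewrite szsign.
(* Bounds the degrees in row i of the Sylvester matrix. *)
pose wt (i : 'I_((size G).-1 + (size P).-1)) := if split i is inl _ then D else m.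
have sw i : (size (Sylvester_mx P G i (perm.fun_of_perm sg i)) <= (wt i).+1)%N.
  rewrite Sylvester_mxE /= /wt; case: (split i) => k;
    by case: (k <= _)%N; rewrite ?mulr0n ?mulr1n ?size_poly0 ?PD ?GD.
apply: (@leq_trans (\sum_i wt i).+1).
  have gen (r : seq 'I_((size G).-1 + (size P).-1)) :
    (size (\prod_(i <- r) Sylvester_mx P G i (perm.fun_of_perm sg i))%R <= (\sum_(i <- r)
      wt i).+1)%N.
    elim: r => [|i r IH]; first by rewrite !big_nil size_poly1.
    rewrite !big_cons; apply: leq_trans (size_polyMleq _ _) _.
    by have := sw i; lia.
  exact: gen.
rewrite ltnS big_split_ord /=.
under eq_bigr => i _ do rewrite /wt -[lshift _ i]/(unsplit (inl i)) unsplitK.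
under [X in (_ + X)%N]eq_bigr => i _ do rewrite /wt -[rshift _ i]/(unsplit (inr i))
  unsplitK.
rewrite !sum_nat_const !card_ord dG leq_add2l leq_mul2r; apply/orP; right.
by rewrite -!subn1 leq_sub2r.
Qed.

(** If [g] is an [e]-th root of [c / f] modulo [N], specialising [Y] to [g] in
    the ideal membership of the resultant shows that [N] divides a nonzero
    polynomial as soon as it divides [P.[g]]; the degree of [N] rules this out.
    This is what makes Stepanov's auxiliary polynomial nonzero. *)
Lemma kummer_no_small_annihilator (N g : {poly K}) (P : {poly {poly K}}) D m :
    P != 0 -> (size P <= e)%N -> (forall i, (size (P`_i)%R <= D.+1)%N) ->
    (size f <= m.+1)%N -> (e * D + e.-1 * m < (size N).-1)%N ->
    N %| f * g ^+ e - c%:P ->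
  ~~ (N %| P.[g]).
Proof.
move=> P0 Pe PD fm szN Ng; apply/negP => NP.
have [P1|P1] := leqP (size P) 1.
  move: NP; rewrite (size1_polyC P1) hornerC => /dvdp_leq.
  have P00 : P`_0 != 0 by move: P0; rewrite {1}(size1_polyC P1) polyC_eq0.
  move=> /(_ P00) NP0; apply: (ltn_pred_absurd szN (leq_trans NP0 (PD 0%N))).
  by rewrite -{1}[D]mul1n (leq_trans (leq_mul e_gt0 (leqnn _))) ?leq_addr.
have szG : (1 < size G)%N by rewrite size_kummer.
have [[u v] /= _ /(congr1 (fun p => p.[g]))] := resultant_in_ideal P1 szG.
rewrite hornerC hornerD !hornerM => RE.
have : N %| resultant P G.
  rewrite RE dvdp_add // dvdp_mull //.
  by rewrite /G hornerD hornerZ hornerN hornerC hornerXn.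
move/dvdp_leq => /(_ (kummer_resultant_neq0 P0 Pe)) Nle.
have P1e : (1 < size P <= e)%N by rewrite P1.
have := leq_trans Nle (size_kummer_resultant P1e PD fm).
by move/(ltn_pred_absurd szN); apply.
Qed.

End KummerNorm.

(** * Two facts of linear and polynomial algebra *)

Lemma linear_dependence (K : fieldType) (I C : finType) (phi : I -> C -> K) :
  (#|C| < #|I|)%N ->
  exists v : I -> K,
    (exists i, v i != 0) /\ forall c, \sum_i v i * phi i c = 0.
Proof.
move=> ltCI.
pose A := \matrix_(i < #|I|, c < #|C|) phi (enum_val i) (enum_val c).
have : kermx A != 0.
  rewrite kermx_eq0 /row_free neq_ltn; apply/orP; left.
  exact: leq_ltn_trans (rank_leq_col A) ltCI.
case/rowV0Pn => w /sub_kermxP wA w0.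
exists (fun i => w 0 (enum_rank i)); split.
  have [i wi] : exists i, w 0 i != 0.
    apply/existsP; move: w0; apply: contraR; rewrite negb_exists => /forallP w0.
    by apply/eqP/rowP => i; rewrite mxE; apply/eqP; move: (w0 i); rewrite negbK.
  by exists (enum_val i); rewrite enum_valK.
move=> c; move/rowP/(_ (enum_rank c)): wA; rewrite !mxE => wAc; rewrite -[RHS]wAc.
rewrite (reindex (enum_val : 'I_#|I| -> I)) /=.
  by apply: eq_bigr => i _; rewrite !mxE enum_valK enum_rankK.
by apply: onW_bij; apply: enum_val_bij.
Qed.

Lemma dvdp_prod_XsubC_exp (K : fieldType) (s : seq K) (p : {poly K}) L :
  uniq s -> {in s, forall x, ('X - x%:P) ^+ L %| p} ->
  \prod_(x <- s) ('X - x%:P) ^+ L %| p.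
Proof.
elim: s => [|x s IH] /=; first by rewrite big_nil dvd1p.
case/andP=> xs us sp; rewrite big_cons Gauss_dvdp.
  rewrite sp ?mem_head //= IH // => y ys; apply: sp.
  by rewrite inE ys orbT.
rewrite coprimep_expl // coprimep_sym coprimep_XsubC.
rewrite prodrXl; case: L {sp IH} => [|L]; first by rewrite expr0 root1.
by rewrite rootE horner_exp expf_eq0 /= -rootE root_prod_XsubC.
Qed.

(** * Scaled Taylor expansions of split polynomials *)

Section TwistedTaylor.

Variables (K : fieldType) (h : nat) (b : 'I_h -> K) (a : 'I_h -> nat).

(** Written [c - X] rather than [X - c] so that evaluation at [x] gives the
    argument [c - x] of the character sums. *)
Definition linp (c : K) : {poly K} := c%:P - 'X.
Definition split_poly : {poly K} := \prod_i linp (b i) ^+ a i.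
Definition radical : {poly K} := \prod_i linp (b i).
Definition cofac i : {poly K} := \prod_(k | k != i) linp (b k).
Definition unit_part : {poly {poly K}} := \prod_i (1 - cofac i *: 'X) ^+ a i.
(** [twisted_taylor p] is [p (X + r Z)] in [K[X][Z]], where [r] is the radical:
    its coefficients are the Hasse derivatives of [p] multiplied by powers of
    [r].  Hasse derivatives are needed because the order of vanishing in
    Stepanov's method exceeds the characteristic, and the factor [r] clears the
    denominators in [(X - b + Z)^n = (X - b)^n (1 + Z / (X - b))^n]. *)
Definition twisted_taylor (p : {poly K}) : {poly {poly K}} :=
  map_poly polyC p \Po (radical *: 'X + 'X%:P).

Lemma twisted_taylorM p q : twisted_taylor (p * q) = twisted_taylor p * twisted_taylor q.
Proof. by rewrite /twisted_taylor rmorphM comp_polyM. Qed.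

Lemma twisted_taylorX : twisted_taylor 'X = radical *: 'X + 'X%:P.
Proof. by rewrite /twisted_taylor map_polyX comp_polyX. Qed.

Lemma twisted_taylor_exp p n : twisted_taylor (p ^+ n) = twisted_taylor p ^+ n.
Proof. by rewrite /twisted_taylor rmorphXn /= rmorphXn. Qed.

Lemma twisted_taylor_linp i : twisted_taylor (linp (b i)) = (linp (b i))%:P * (1 - cofac
  i *: 'X).
Proof.
rewrite /twisted_taylor /linp rmorphB /= map_polyC map_polyX /= comp_polyB comp_polyC
  comp_polyX.
rewrite mulrBr mulr1 mul_polyC scalerA.
have -> : (b i)%:P - 'X = linp (b i) by [].
have -> : radical = linp (b i) * cofac i by rewrite /radical (bigD1 i).
by rewrite /linp polyCB opprD addrA addrAC.
Qed.

(** The expansion of any power of [f] is that power times a polynomial with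
    coefficients of small degree, however large the exponent: this lets
    [f^((Q-1)/e)] be replaced by its value at a point. *)
Lemma twisted_taylor_split : twisted_taylor split_poly = split_poly%:P * unit_part.
Proof.
rewrite /split_poly /unit_part rmorph_prod /= -big_split /=.
rewrite (big_morph twisted_taylor twisted_taylorM (id1 := 1)); last by rewrite
  /twisted_taylor rmorph1 comp_polyC.
by apply: eq_bigr => i _; rewrite twisted_taylor_exp twisted_taylor_linp exprMn polyC_exp.
Qed.

(** Degree at most [n] in [X] once [Z] is given weight [- h]: a grading for
    which [X + r Z] has degree at most 1 and [unit_part] degree at most 0. *)
Definition slope_bounded (A : {poly {poly K}}) n :=
  forall l, (size (A`_l)%R <= (n + l * h).+1)%N.

Lemma slope_boundedM A B n1 n2 :
  slope_bounded A n1 -> slope_bounded B n2 -> slope_bounded (A * B) (n1 + n2).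
Proof.
move=> HA HB l; rewrite coefM.
apply: leq_trans (size_sum _ _ _) _; apply/bigmax_leqP => j _.
apply: leq_trans (size_polyMleq _ _) _.
have := HA j; have := HB (l - j)%N; have := ltn_ord j.
set s1 := size _; set s2 := size _ => jl H1 H2.
have -> : (l * h = j * h + (l - j) * h)%N by rewrite -mulnDl subnKC // -ltnS.
lia.
Qed.

Lemma slope_bounded1 : slope_bounded 1 0.
Proof. by move=> l; rewrite coef1; case: (l == 0)%N; rewrite ?size_poly1 ?size_poly0. Qed.

Lemma slope_bounded_exp A n k : slope_bounded A n -> slope_bounded (A ^+ k) (n * k).
Proof.
move=> HA; elim: k => [|k IH]; first by rewrite muln0; exact: slope_bounded1.
by rewrite exprS mulnS; exact: slope_boundedM.
Qed.

Lemma slope_boundedC (p : {poly K}) n : (size p <= n.+1)%N -> slope_bounded p%:P n.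
Proof.
move=> sp l; rewrite coefC; case: eqP => [->|_]; last by rewrite size_poly0.
by rewrite mul0n addn0.
Qed.

Lemma size_linp c : size (linp c) = 2.
Proof. by rewrite /linp -opprB size_polyN size_XsubC. Qed.

Lemma size_prod_linp (P : pred 'I_h) : (size (\prod_(k | P k) linp (b k))%R <= h.+1)%N.
Proof.
apply: (@leq_trans (\sum_(k | P k) 1).+1).
  elim/big_rec2: _ => [|i m p _ IH]; first by rewrite size_poly1.
  by apply: leq_trans (size_polyMleq _ _) _; rewrite size_linp.
by rewrite ltnS sum1_card -[X in (_ <= X)%N]card_ord max_card.
Qed.

Lemma slope_bounded_unit_part : slope_bounded unit_part 0.
Proof.
rewrite /unit_part; elim/big_ind: _ => [|A B HA HB|i _]; first exact: slope_bounded1.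
  exact: (slope_boundedM HA HB).
rewrite -(mul0n (a i)); apply: slope_bounded_exp => l.
rewrite coefB coef1 coefZ coefX.
case: l => [|[|l]] /=; rewrite ?mulr0 ?subr0 ?mulr1 ?sub0r ?size_poly1 ?size_poly0
  ?size_polyN //.
by rewrite mul1n add0n size_prod_linp.
Qed.

Lemma slope_bounded_twisted_taylorX : slope_bounded (twisted_taylor 'X) 1.
Proof.
move=> l; rewrite twisted_taylorX coefD coefZ coefX coefC.
case: l => [|[|l]] /=; rewrite ?mulr0 ?addr0 ?mulr1 ?add0r ?size_polyX ?size_poly0 //.
by rewrite mul1n add1n; apply: leq_trans (size_prod_linp _) _.
Qed.

Definition twist_at x := radical.[x] *: 'X + x%:P.

Lemma horner_twisted_taylor x p : map_poly (horner_eval x) (twisted_taylor p) = p \Po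
  twist_at x.
Proof.
rewrite /twisted_taylor map_comp_poly -map_poly_comp map_poly_id; last first.
  by move=> c _ /=; rewrite /horner_eval hornerC.
congr (_ \Po _); rewrite /twist_at rmorphD /= map_polyZ /= map_polyX map_polyC /=.
by rewrite /horner_eval hornerX.
Qed.

Lemma radical_neq0 x : split_poly.[x] != 0 -> (forall i, (0 < a i)%N) -> radical.[x] != 0.
Proof.
rewrite !horner_prod => /prodf_neq0 H a0; apply/prodf_neq0 => i _.
by have := H i isT; rewrite horner_exp expf_eq0 a0.
Qed.

(** [r] does not vanish at [x], so [X + r(x) Z] is a change of variable there. *)
Lemma Xn_dvd_twist_at x L (p : {poly K}) : radical.[x] != 0 ->
  'X^L %| p \Po twist_at x -> ('X - x%:P) ^+ L %| p.
Proof.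
move=> r0 /dvdpP [q E].
have inv : twist_at x \Po (radical.[x]^-1 *: ('X - x%:P)) = 'X.
  rewrite /twist_at comp_polyD comp_polyZ comp_polyX comp_polyC scalerA mulfV //.
  by rewrite scale1r subrK.
have := congr1 (fun p => p \Po (radical.[x]^-1 *: ('X - x%:P))) E.
rewrite -comp_polyA inv comp_polyXr comp_polyM rmorphXn /= comp_polyX exprZn => ->.
by rewrite dvdp_mull // dvdpZr ?expf_neq0 ?invr_eq0.
Qed.

End TwistedTaylor.

(** * Stepanov's auxiliary polynomial *)

(** With [g = f^M] and [M = (Q - 1) / e], a polynomial
    [\sum_(i, j) k_ij (X - x0)^(j Q) g^i] with [i < e], [j < J] and
    [deg k_ij < D] has [e J D] free coefficients.  At a point [x] with [x^Q = x]
    and [g(x) = w] its first [L] scaled Taylor coefficients agree with the values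
    at [x] of the polynomials [\sum v_i *: (tbas w i)`_l], in which [Q] no longer
    occurs in the degrees.  Hence about [L (D + J + L h)] linear conditions make
    it vanish to order [L] at all these points at once. *)

Section Stepanov.

Variables (K : fieldType) (h : nat) (b : 'I_h -> K) (a : 'I_h -> nat).
Variables (Q M e : nat).
Hypotheses (e_gt0 : (0 < e)%N) (QM : Q = (M * e).+1).
Hypothesis pcharQ : [pchar K].-nat Q.
Hypothesis bQ : forall i, b i ^+ Q = b i.
Hypothesis a_gt0 : forall i, (0 < a i)%N.
Hypothesis a_prim : forall s, (0 < s < e)%N -> exists c,
  ~~ (e %| s * mup c (split_poly b a))%N.
Variable x0 : K.
Hypotheses (x0Q : x0 ^+ Q = x0) (fx0 : (split_poly b a).[x0] != 0).

Local Notation f := (split_poly b a).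
Local Notation g := (f ^+ M).
Local Notation N := (('X - x0%:P) ^+ Q).

Let Q_gt0 : (0 < Q)%N. Proof. by rewrite QM. Qed.

Let addrXQ (p q : {poly K}) : (p + q) ^+ Q = p ^+ Q + q ^+ Q.
Proof. by apply: exprDn_pchar; rewrite (eq_pnat _ (pchar_poly K)). Qed.

Let addrXQ_base (p q : K) : (p + q) ^+ Q = p ^+ Q + q ^+ Q.
Proof. by apply: exprDn_pchar. Qed.

Let opprXQ_base (p : K) : (- p) ^+ Q = - p ^+ Q.
Proof.
by apply/eqP; rewrite -addr_eq0 -addrXQ_base addrC subrr expr0n eqn0Ngt Q_gt0.
Qed.

Let opprXQ (p : {poly K}) : (- p) ^+ Q = - p ^+ Q.
Proof.
by apply/eqP; rewrite -addr_eq0 -addrXQ addrC subrr expr0n eqn0Ngt Q_gt0.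
Qed.

Let f_neq0 : f != 0.
Proof. by apply: contraNneq fx0 => ->; rewrite horner0. Qed.

(** [f * g^e = f^Q], and [f^Q] is [f] evaluated at [X^Q], since the roots of [f]
    are fixed by [Q]-th powers; modulo [(X - x0)^Q] this is the constant
    [f(x0)]. *)
Lemma split_poly_frob : N %| f * g ^+ e - (f.[x0])%:P.
Proof.
have -> : f * g ^+ e = f ^+ Q by rewrite -exprM -exprS -QM.
have linQ i : linp (b i) ^+ Q = (b i - x0)%:P - N.
  rewrite /linp addrXQ opprXQ -polyC_exp bQ addrXQ opprXQ -[x0%:P ^+ Q]polyC_exp x0Q.
  by rewrite polyCB opprD opprK addrCA subrK addrC.
suff [W ->] : exists W, f ^+ Q = (f.[x0])%:P + N * W.
  by rewrite addrAC subrr add0r dvdp_mulr.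
rewrite /split_poly -prodrXl horner_prod.
elim/big_rec2: _ => [|i v p _ [W ->]].
  by exists 0; rewrite mulr0 addr0.
rewrite exprAC linQ horner_exp /linp !hornerE.
have [V ->] : exists V, ((b i - x0)%:P - N) ^+ a i = ((b i - x0) ^+ a i)%:P + N * V.
  elim: (a i) => [|n [V E]]; first by exists 0; rewrite !expr0 mulr0 addr0.
  exists ((b i - x0)%:P * V - ((b i - x0) ^+ n)%:P - N * V).
  by rewrite exprS E exprS polyCM; ring.
exists (((b i - x0) ^+ a i)%:P * W + V * v%:P + V * N * W).
by rewrite polyCM; ring.
Qed.

Variables (D J L m : nat).
Hypothesis D_gt0 : (0 < D)%N.
Hypothesis szf : (size f <= m.+1)%N.
Hypothesis small : (e * D.-1 + e.-1 * m < Q)%N.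
Hypothesis room : (L * (D + J + L * h) < e * J * D)%N.
Hypotheses (LQ : (L <= Q)%N) (DQ : (D <= Q)%N).

Let I : finType := ('I_e * 'I_J * 'I_D)%type.
Let hbas (i : I) : {poly K} := 'X^(i.2) * N ^+ i.1.2 * g ^+ i.1.1.
Let tbas (w : K) (i : I) : {poly {poly K}} :=
  twisted_taylor b 'X^(i.2) * (('X - x0%:P) ^+ i.1.2 * (w ^+ i.1.1)%:P)%:P
  * unit_part b a ^+ (M * i.1.1).

(** Below order [Q], the factor [(X - x0)^Q] expands to the constant [x - x0]. *)
Lemma stepanov_aux_vanish (v : I -> K) w x :
    (forall l, (l < L)%N -> (\sum_i v i *: (map_poly (horner_eval x) (tbas w i)))`_l = 0)
      ->
    x ^+ Q = x -> f.[x] != 0 -> f.[x] ^+ M = w ->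
  ('X - x%:P) ^+ L %| \sum_i v i *: hbas i.
Proof.
move=> vL xQ fx0' fxw.
have r0 : (radical b).[x] != 0 by apply: radical_neq0 fx0' a_gt0.
apply: (Xn_dvd_twist_at r0).
set Phi := \sum_i _ in vL.
have PhiL : 'X^L %| Phi.
  apply/dvdpP; exists (drop_poly L Phi).
  rewrite -[LHS](poly_take_drop L) [take_poly _ _](_ : _ = 0) ?add0r //.
  by apply/polyP => l; rewrite coef_take_poly coef0; case: ifP => // /vL.
suff : 'X^Q %| (\sum_i v i *: hbas i) \Po twist_at b x - Phi.
  move/(dvdp_trans (dvdp_exp2l 'X LQ)) => dvQ.
  by rewrite -(subrK Phi (_ \Po _)) dvdp_add.
rewrite raddf_sum /= /Phi -sumrB.
elim/big_ind: _ => [|p q Hp Hq|i _]; [exact: dvdp0 | by rewrite dvdp_add |].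
rewrite comp_polyZ -scalerBr -mul_polyC; apply: dvdp_mull.
have evf : f \Po twist_at b x = (f.[x])%:P * map_poly (horner_eval x) (unit_part b a).
  by rewrite -horner_twisted_taylor twisted_taylor_split rmorphM /= map_polyC.
have NE : N \Po twist_at b x = (x - x0)%:P + ((radical b).[x] ^+ Q)%:P * 'X^Q.
  rewrite rmorphXn /= comp_polyB comp_polyX comp_polyC /twist_at -addrA -polyCB.
  by rewrite addrXQ exprZn -polyC_exp addrXQ_base xQ opprXQ_base x0Q addrC mul_polyC.
have cX (p : {poly K}) n : p ^+ n \Po twist_at b x = (p \Po twist_at b x) ^+ n.
  by rewrite rmorphXn.
rewrite /hbas /tbas !comp_polyM (cX N) NE (cX g) (cX f) evf -horner_twisted_taylor.
rewrite [in X in _ - X]rmorphM /= [in X in _ - X]rmorphM /= map_polyC /= [map_poly _ (_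
  ^+ (M * _))]rmorphXn /=.
rewrite /horner_eval !hornerE.
set A := map_poly _ _; set U := map_poly _ _.
have [V ->] : exists V, ((x - x0)%:P + ((radical b).[x] ^+ Q)%:P * 'X^Q) ^+ i.1.2
     = ((x - x0) ^+ i.1.2)%:P + 'X^Q * V.
  elim: (i.1.2 : nat) => [|n [V E]]; first by exists 0; rewrite !expr0 mulr0 addr0.
  exists ((x - x0)%:P * V + ((radical b).[x] ^+ Q)%:P * (((x - x0) ^+ n)%:P + 'X^Q * V)).
  by rewrite exprS E exprS polyCM; ring.
rewrite exprMn -polyC_exp fxw exprMn -polyC_exp -!exprM polyCM.
apply/dvdpP; exists (A * V * (w ^+ i.1.1)%:P * U ^+ (M * i.1.1)).
by ring.
Qed.

(** Dividing by the lowest power of [(X - x0)^Q] that occurs leaves a polynomial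
    congruent to a combination of the [g^i] with small coefficients, which
    [kummer_no_small_annihilator] shows to be nonzero modulo [(X - x0)^Q]. *)
Lemma stepanov_aux_neq0 (v : I -> K) : (exists i, v i != 0) ->
  \sum_i v i *: hbas i != 0.
Proof.
case=> i0 vi0.
pose k (i : nat) (j : nat) : {poly K} :=
  \poly_(d < D) (if (insub i, insub j, insub d) is (Some i', Some j', Some d')
                 then v (i', j', d') else 0).
pose P j : {poly {poly K}} := \poly_(i < e) k i j.
have sumE : \sum_i v i *: hbas i = \sum_(j < J) (P j).[g] * N ^+ j.
  transitivity (\sum_i \sum_j \sum_d v (i, j, d) *: hbas (i, j, d)).
    by rewrite pair_bigA pair_bigA /=; apply: eq_bigr => -[[i j] d] _.
  rewrite exchange_big /=; apply: eq_bigr => j _.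
  rewrite /P horner_poly mulr_suml; apply: eq_bigr => i _.
  rewrite /k poly_def !mulr_suml; apply: eq_bigr => d _.
  by rewrite !valK /hbas /= -!scalerAl; congr (_ *: _); rewrite mulrAC.
have P_ne : exists j, (j < J)%N && (P j != 0).
  exists i0.1.2; rewrite ltn_ord /=; apply: contraNneq vi0 => P0.
  have := congr1 (fun p : {poly {poly K}} => (p`_(i0.1.1))`_(i0.2)) P0.
  rewrite /P coef_poly ltn_ord /k coef_poly ltn_ord !valK coef0 coef0 => <-.
  by case: (i0) => [[]].
pose j0 := ex_minn P_ne.
have [j0J Pj0 j0min] : [/\ (j0 < J)%N, P j0 != 0 & forall j, (j < j0)%N -> P j = 0].
  rewrite /j0; case: ex_minnP => j1 /andP[jJ Pj] jm; split=> // j jj.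
  apply/eqP/negPn/negP => Pj'; have := jm j.
  by rewrite (ltn_trans jj jJ) Pj' leqNgt jj => /(_ isT).
rewrite sumE; apply/negP => /eqP H0.
have [W HW] : exists W, \sum_(j < J) (P j).[g] * N ^+ j = N ^+ j0 * ((P j0).[g] + N * W).
  exists (\sum_(j < J | (j0 < j)%N) (P j).[g] * N ^+ (j - j0.+1)).
  rewrite (bigD1 (Ordinal j0J)) //= mulrDr [in RHS]mulrC; congr (_ + _).
  rewrite mulrA -exprSr mulr_sumr big_mkcond [RHS]big_mkcond /=.
  apply: eq_bigr => j _; case: (ltngtP j0 j) => [ltj|ltj|eqj].
  - rewrite -(inj_eq val_inj) /= gtn_eqF //= mulrCA -exprD subnKC //.
  - by rewrite j0min // horner0 mul0r if_same.
  - by rewrite -(inj_eq val_inj) /= eqj eqxx.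
move/eqP: H0; rewrite HW mulf_eq0 !expf_eq0 polyXsubC_eq0 !andbF /= addr_eq0 => /eqP PN.
have : N %| (P j0).[g] by rewrite PN dvdpNr dvdp_mulIl.
apply/negP.
apply: (kummer_no_small_annihilator f_neq0 fx0 e_gt0 a_prim (D := D.-1) (m := m)) => //.
- exact: size_poly.
- move=> i; rewrite prednK // /P coef_poly; case: ifP => _; last by rewrite size_poly0.
  exact: size_poly.
- by rewrite size_exp_XsubC.
- exact: split_poly_frob.
Qed.

Lemma stepanov_aux_exists (w : K) : exists v : I -> K,
  (exists i, v i != 0) /\
  forall x l, (l < L)%N -> (\sum_i v i *: (map_poly (horner_eval x) (tbas w i)))`_l = 0.
Proof.
pose W := (D + J + L * h)%N.
pose phi (i : I) (c : 'I_L * 'I_W) : K := ((tbas w i)`_c.1)`_c.2.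
have [|v [v0 vphi]] := @linear_dependence K I ('I_L * 'I_W)%type phi.
  by rewrite !card_prod !card_ord.
exists v; split=> // x l lL.
have bd i : slope_bounded h (tbas w i) (D.-1 + J.-1).
  rewrite /tbas -[(D.-1 + J.-1)%N]addn0; apply: slope_boundedM; last first.
    rewrite -(mul0n (M * i.1.1)).
    exact/slope_bounded_exp/slope_bounded_unit_part.
  have dD : (i.2 <= D.-1)%N by have := ltn_ord i.2; lia.
  have jJ : (i.1.2 <= J.-1)%N by have := ltn_ord i.1.2; lia.
  have bX := slope_bounded_exp i.2 (slope_bounded_twisted_taylorX b).
  move=> l'; apply: leq_trans (_ : (1 * i.2 + i.1.2 + l' * h).+1 <= _)%N; last by lia.
  move: l'; apply: slope_boundedM; first by rewrite twisted_taylor_exp.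
  apply: slope_boundedC; rewrite mulrC mul_polyC.
  by apply: leq_trans (size_scale_leq _ _) _; rewrite size_exp_XsubC.
have coefl : \sum_i v i *: (tbas w i)`_l = 0.
  apply/polyP => d; rewrite coef_sum coef0.
  have [dW|Wd] := ltnP d W.
    rewrite -[RHS](vphi (Ordinal lL, Ordinal dW)); apply: eq_bigr => i _.
    by rewrite coefZ.
  rewrite big1 // => i _; rewrite coefZ nth_default ?mulr0 //.
  apply: leq_trans (bd i l) _; apply: leq_trans Wd; rewrite /W.
  have := leq_mul (ltnW lL) (leqnn h).
  by move: (l * h)%N (L * h)%N => u1 u2; lia.
rewrite coef_sum -[RHS](horner0 x) -coefl horner_sum.
by apply: eq_bigr => i _; rewrite coefZ coef_map /= hornerZ.
Qed.

Theorem stepanov_bound (w : K) (T : seq K) : uniq T ->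
    {in T, forall x, [/\ x ^+ Q = x, f.[x] != 0 & f.[x] ^+ M = w]} ->
  (L * size T <= (J + m) * Q)%N.
Proof.
move=> uT HT.
have [v [v0 vL]] := stepanov_aux_exists w.
have H0 := stepanov_aux_neq0 v0.
have dv : \prod_(x <- T) ('X - x%:P) ^+ L %| \sum_i v i *: hbas i.
  apply: dvdp_prod_XsubC_exp => // x /HT [xQ fx fxw].
  exact: stepanov_aux_vanish (vL x) xQ fx fxw.
have := dvdp_leq H0 dv; rewrite prodrXl.
rewrite [X in (X <= _)%N]polySpred ?expf_neq0 ?monic_neq0 ?monic_prod_XsubC //.
rewrite size_exp size_prod_XsubC /= mulnC => szT.
have szH : (size (\sum_i v i *: hbas i)%R <= ((J + m) * Q).+1)%N.
  apply: leq_trans (size_sum _ _ _) _; apply/bigmax_leqP => -[[i j] d] _.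
  apply: leq_trans (size_scale_leq _ _) _; rewrite /hbas /=.
  apply: leq_trans (size_polyMleq _ _) _.
  have s1 : (size (g ^+ i)%R <= (m * M * i).+1)%N.
    rewrite -exprM; apply: leq_trans (size_poly_exp_leq _ _) _.
    by rewrite ltnS mulnA !leq_mul // -ltnS prednK // size_poly_gt0.
  have s2 : (size ('X^d * N ^+ j : {poly K})%R <= (d + Q * j).+1)%N.
    apply: leq_trans (size_polyMleq _ _) _.
    by rewrite size_polyXn -exprM size_exp_XsubC addnS.
  have s3 : (m * M * i <= m * Q)%N.
    by rewrite -mulnA leq_mul // QM leqW // leq_mul // ltnW.
  have s4 : (d + Q * j <= J * Q)%N.
    have dQ : (d <= Q)%N by apply: leq_trans (ltnW (ltn_ord d)) DQ.
    apply: leq_trans (_ : Q + Q * j <= _)%N; first by rewrite leq_add2r.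
    by rewrite -mulnS mulnC leq_mul.
  rewrite mulnDl; move: s1 s2 s3 s4; set A1 := size _; set A2 := size _; lia.
exact: leq_trans szT szH.
Qed.

End Stepanov.

(** * Character sums over monic polynomials *)

Section MonicSums.

Variable F : finFieldType.

Definition monics n : seq {poly F} :=
  [seq 'X^n + rVpoly t | t <- enum {: 'rV[F]_n}].

Lemma size_rVpoly n (t : 'rV[F]_n) : (size (rVpoly t) <= n)%N.
Proof. exact: size_poly. Qed.

Lemma mem_monics n (g : {poly F}) : (g \in monics n) = (g \is monic) && (size g == n.+1).
Proof.
apply/mapP/andP => [[t _ ->]|[gm /eqP sg]].
  have lt : (size (rVpoly t) < size ('X^n : {poly F}))%N.
    by rewrite size_polyXn ltnS size_rVpoly.
  split; first by rewrite monicE lead_coefDl // lead_coefXn.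
  by rewrite size_polyDl // size_polyXn.
exists (poly_rV (g - 'X^n)); rewrite ?mem_enum // poly_rV_K ?subrKC //.
apply/leq_sizeP => j nj; rewrite coefB coefXn.
have [->|ne] := eqVneq j n.
  by move: gm; rewrite monicE lead_coefE sg => /eqP ->; rewrite subrr.
by rewrite nth_default ?subr0 // sg ltn_neqAle eq_sym ne.
Qed.

Lemma uniq_monics n : uniq (monics n).
Proof.
rewrite map_inj_uniq ?enum_uniq // => t1 t2 /addrI.
exact: (can_inj (@rVpolyK _ _)).
Qed.

Lemma monics0 : monics 0 = [:: 1].
Proof.
have m1 : 1 \in monics 0 by rewrite mem_monics monic1 size_poly1.
have : size (monics 0) = 1%N by rewrite size_map -cardE card_mx expn0.
by case: (monics 0) m1 => [|x [|]] //; rewrite inE => /eqP ->.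
Qed.

Lemma monics_dvd n k (d : {poly F}) : d \is monic -> size d = k.+1 -> (k <= n)%N ->
  perm_eq [seq g <- monics n | d %| g] [seq d * g | g <- monics (n - k)].
Proof.
move=> dm sd kn; apply: uniq_perm.
- exact/filter_uniq/uniq_monics.
- by rewrite map_inj_uniq ?uniq_monics //; apply/mulfI/monic_neq0.
move=> g; rewrite mem_filter mem_monics; apply/idP/mapP.
  case/and3P=> /dvdpP[u ->] um /eqP su.
  have um' : u \is monic by rewrite -(monicMr _ dm).
  exists u; last by rewrite mulrC.
  rewrite mem_monics um' /=.
  have cancel_size s : (s + k.+1).-1 = n.+1 -> s == (n - k).+1 by lia.
  move: su; rewrite size_proper_mul ?(monicP um') ?(monicP dm) ?mulr1 ?oner_neq0 // sd.
  exact: cancel_size.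
case=> u; rewrite mem_monics => /andP[um /eqP su] ->.
rewrite dvdp_mulIl monicMl //= um.
by rewrite size_proper_mul ?(monicP um) ?(monicP dm) ?mulr1 ?oner_neq0 // sd su addSn
  addnS /= subnKC.
Qed.

Variables (C : numClosedFieldType) (h : nat) (b : 'I_h -> F) (chi : 'I_h -> F -> C).
Hypothesis b_inj : injective b.
Hypothesis chi1 : forall i, chi i 1 = 1.
Hypothesis chiM : forall i x y, chi i (x * y) = chi i x * chi i y.

(** Completely multiplicative in [g]; on [X - x] it is the summand of the
    character sum to be bounded. *)
Definition char_eval (g : {poly F}) : C := \prod_i chi i (g.[b i]).

Lemma char_eval1 : char_eval 1 = 1.
Proof. by rewrite /char_eval big1 // => i _; rewrite hornerE chi1. Qed.

Lemma char_evalM f g : char_eval (f * g) = char_eval f * char_eval g.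
Proof. by rewrite /char_eval -big_split /=; apply: eq_bigr => i _; rewrite hornerM chiM.
  Qed.

(** The coefficients of the L-function attached to [char_eval]. *)
Definition Lcoef n := \sum_(g <- monics n) char_eval g.

Lemma Lcoef0 : Lcoef 0 = 1.
Proof. by rewrite /Lcoef monics0 big_seq1 char_eval1. Qed.

Lemma Lcoef1 : Lcoef 1 = \sum_x \prod_i chi i (b i - x).
Proof.
rewrite /Lcoef.
have P : perm_eq (monics 1) [seq 'X - x%:P | x <- enum F].
  apply: uniq_perm; first exact: uniq_monics.
    by rewrite map_inj_uniq ?enum_uniq // => x y /addrI /oppr_inj /polyC_inj.
  move=> g; rewrite mem_monics; apply/andP/mapP => [[gm /eqP sg]|[x _ ->]].
    exists (- g`_0); rewrite ?mem_enum //.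
    apply/polyP => -[|[|j]]; rewrite coefB coefX coefC ?subr0 ?sub0r ?opprK //=.
      by move: gm; rewrite monicE lead_coefE sg => /eqP.
    by rewrite nth_default // sg.
  by rewrite monicXsubC size_XsubC.
rewrite (perm_big _ P) big_map big_enum /=; apply: eq_bigr => x _.
by apply: eq_bigr => i _; rewrite hornerXsubC.
Qed.

(** A monic polynomial of degree at least [h] can be modified by a Lagrange
    polynomial so as to multiply its value at [b i0] by [u] and to keep its
    values at the other points; this permutes the monic polynomials of degree
    [n], and multiplies the sum by [chi i0 u]. *)
Lemma Lcoef_vanish (i0 : 'I_h) u n : chi i0 u != 1 -> u != 0 -> (h <= n)%N -> Lcoef n = 0.
Proof.
move=> chiu u0 hn.
pose l0 : {poly F} := \prod_(k | k != i0) ('X - (b k)%:P).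
have l0b : l0.[b i0] != 0.
  rewrite horner_prod; apply/prodf_neq0 => k ki.
  by rewrite hornerXsubC subr_eq0 (inj_eq b_inj) eq_sym.
pose l := (l0.[b i0])^-1 *: l0.
have lb : l.[b i0] = 1 by rewrite hornerZ mulVf.
have lb0 k : k != i0 -> l.[b k] = 0.
  by move=> ki; rewrite hornerZ [X in _ * X]horner_prod (bigD1 k) //= hornerXsubC subrr
    mul0r mulr0.
have sl : (size l <= n)%N.
  apply: leq_trans (size_scale_leq _ _) _; apply: leq_trans hn.
  rewrite /l0 size_prod => [|k _]; last by rewrite polyXsubC_eq0.
  under eq_bigr => k _ do rewrite size_XsubC.
  rewrite sum_nat_const.
  have := cardC1 i0; rewrite card_ord => ->.
  by have := ltn_ord i0; lia.
pose phi (g : {poly F}) := g + ((u - 1) * g.[b i0]) *: l.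
have phib g : (phi g).[b i0] = u * g.[b i0].
  by rewrite hornerD hornerZ lb mulr1 mulrBl mul1r subrKC.
have phik g k : k != i0 -> (phi g).[b k] = g.[b k].
  by move=> ki; rewrite hornerD hornerZ lb0 // mulr0 addr0.
have phi_inj : injective phi.
  move=> g1 g2 E; have := congr1 (fun p => p.[b i0]) E.
  rewrite !phib => /(mulfI u0) E0.
  by move: E; rewrite /phi E0 => /addIr.
have P : perm_eq (monics n) [seq phi g | g <- monics n].
  have U : uniq [seq phi g | g <- monics n] by rewrite map_inj_uniq ?uniq_monics.
  rewrite perm_sym; apply: uniq_perm; rewrite ?uniq_monics //.
  suff sub : {subset [seq phi g | g <- monics n] <= monics n}.
    by have [|_] := uniq_min_size U sub; rewrite ?size_map.
  move=> _ /mapP[g + ->]; rewrite !mem_monics => /andP[gm /eqP sg].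
  have lt : (size (((u - 1) * g.[b i0]) *: l) < size g)%N.
    by rewrite sg ltnS; apply: leq_trans (size_scale_leq _ _) sl.
  by rewrite monicE lead_coefDl // -monicE gm size_polyDl // sg eqxx.
have E : Lcoef n = chi i0 u * Lcoef n.
  rewrite {1}/Lcoef (perm_big _ P) big_map /Lcoef mulr_sumr; apply: eq_bigr => g _.
  rewrite /char_eval (bigD1 i0) //= phib chiM -mulrA; congr (_ * _).
  rewrite [RHS](bigD1 i0) //=; congr (_ * _).
  by apply: eq_bigr => k ki; rewrite phik.
apply/eqP; move/eqP: E; rewrite -subr_eq0 -{1}[Lcoef n]mul1r -mulrBl mulf_eq0.
by rewrite subr_eq0 eq_sym (negPf chiu).
Qed.

End MonicSums.

(** * Frobenius in an algebraically closed extension *)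

Lemma card_finField_pnat (F : finFieldType) : [pchar F].-nat #|F|.
Proof.
have [p pp pF] := finPcharP F.
rewrite (card_pprimeChar pF) pnatX (eq_pnat _ (pcharf_eq pF)) pnat_id ?orbT //.
Qed.

Section Frobenius.

Variables (F : finFieldType) (K : closedFieldType) (iota : {rmorphism F -> K}).

Local Notation q := #|F|.

Lemma card_gt1 : (1 < q)%N.
Proof. exact: finNzRing_gt1. Qed.

Lemma card_exp_gt1 n : (0 < n)%N -> (1 < q ^ n)%N.
Proof.
move=> n0; apply: leq_trans card_gt1 _.
by rewrite -{1}[q]expn1 leq_pexp2l // ltnW // card_gt1.
Qed.

Lemma pnat_pchar_card n : [pchar K].-nat (q ^ n)%N.
Proof. by rewrite pnatX (eq_pnat _ (fmorph_pchar iota)) card_finField_pnat. Qed.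

(** The embedding [iota] is a parameter because it is what shows that [K] has the
    characteristic of [F]. *)
Definition frob (x : K) : K := let _ := iota in x ^+ q.

Lemma frob_is_zmod_morphism : zmod_morphism frob.
Proof.
move=> x y; rewrite /frob.
have fD u v : (u + v) ^+ q = u ^+ q + v ^+ q :> K.
  by apply: exprDn_pchar; have := pnat_pchar_card 1; rewrite expn1.
rewrite fD; congr (_ + _); apply/eqP.
by rewrite -addr_eq0 -fD addrC subrr expr0n eqn0Ngt ltnW // card_gt1.
Qed.

Lemma frob_is_monoid_morphism : monoid_morphism frob.
Proof. by split=> [|x y]; rewrite /frob ?expr1n ?exprMn. Qed.

HB.instance Definition _ := GRing.isZmodMorphism.Build K K frob frob_is_zmod_morphism.
HB.instance Definition _ := GRing.isMonoidMorphism.Build K K frob frob_is_monoid_morphism.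

Lemma iter_frob n x : iter n frob x = x ^+ (q ^ n).
Proof.
elim: n => [|n IH]; first by rewrite expr1.
by rewrite iterS IH /frob -exprM expnSr.
Qed.

Lemma frob_iota u : frob (iota u) = iota u.
Proof. by rewrite /frob -rmorphXn /= expf_card. Qed.

(** The inverse of [iota] on its image, which is the fixed field of [frob]. *)
Definition iota_inv (y : K) : F := odflt 0 [pick u | iota u == y].

Lemma iotaK : cancel iota iota_inv.
Proof.
move=> u; rewrite /iota_inv; case: pickP => [v /eqP /fmorph_inj //|/(_ u)].
by rewrite eqxx.
Qed.

Lemma iota_invK y : frob y = y -> iota (iota_inv y) = y.
Proof.
move=> fy; have : root (map_poly iota ('X^q - 'X)) y.
  by rewrite rmorphB /= map_polyXn map_polyX rootE !hornerE subr_eq0; apply/eqP.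
rewrite finField_genPoly rmorph_prod /= -big_enum /=.
under eq_bigr => x _ do rewrite rmorphB /= map_polyX map_polyC /=.
rewrite -(big_map iota xpredT (fun z => 'X - z%:P)) root_prod_XsubC.
by case/mapP => x _ ->; rewrite iotaK.
Qed.

(** For [n > 0], the subfield of [K] with [q ^ n] elements, as a list. *)
Definition frob_fixpts n : seq K := sval (closed_field_poly_normal ('X^(q ^ n) - 'X :
  {poly K})).

Lemma size_XnsubX n : (0 < n)%N -> size ('X^(q ^ n) - 'X : {poly K}) = (q ^ n).+1%N.
Proof.
move=> n0; rewrite size_polyDl ?size_polyXn // size_polyN size_polyX ltnS.
exact: card_exp_gt1.
Qed.

Lemma frob_fixpts_prod n : (0 < n)%N -> 'X^(q ^ n) - 'X = \prod_(z <- frob_fixpts n) ('X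
  - z%:P).
Proof.
move=> n0; rewrite /frob_fixpts; case: closed_field_poly_normal => r /= {1}->.
rewrite lead_coefDl; first by rewrite lead_coefXn scale1r.
rewrite size_polyN size_polyX size_polyXn ltnS.
exact: card_exp_gt1.
Qed.

Lemma mem_frob_fixpts n x : (0 < n)%N -> (x \in frob_fixpts n) = (x ^+ (q ^ n) == x).
Proof.
by move=> n0; rewrite -root_prod_XsubC -frob_fixpts_prod // rootE !hornerE subr_eq0.
Qed.

Lemma size_frob_fixpts n : (0 < n)%N -> size (frob_fixpts n) = (q ^ n)%N.
Proof.
move=> n0; have := size_XnsubX n0.
by rewrite frob_fixpts_prod // size_prod_XsubC => -[].
Qed.

Lemma uniq_frob_fixpts n : (0 < n)%N -> uniq (frob_fixpts n).
Proof.
move=> n0; rewrite -separable_prod_XsubC -frob_fixpts_prod //.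
rewrite separable_poly.unlock derivB derivXn derivX.
have -> : ('X^((q ^ n).-1) *+ (q ^ n) : {poly K}) = 0.
  rewrite -mulr_natr; suff -> : (q ^ n)%N%:R = 0 :> {poly K} by rewrite mulr0.
  have [p pp pF] := finPcharP F.
  have pK : p \in [pchar {poly K}] by rewrite pchar_poly (fmorph_pchar iota).
  apply/eqP; rewrite -(dvdn_pcharf pK).
  have [l ql] : exists l, q = (p ^ l)%N by exists (logn p q); exact: (card_pprimeChar pF).
  by rewrite dvdn_exp // ql; case: l ql (card_gt1) => [->|l _] //; rewrite expnS
    dvdn_mulr.
by rewrite sub0r -[X in coprimep _ X]scaleN1r coprimepZr ?coprimep1 // oppr_eq0 oner_neq0.
Qed.

(** For [x] fixed by the [k]-th power of Frobenius this is the norm of [X - x]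
    from the field with [q ^ k] elements to [F], that is, a power of the minimal
    polynomial of [x]. *)
Definition norm_poly k x : {poly K} := \prod_(i < k) ('X - (iter i frob x)%:P).

Lemma norm_polyD k l x : norm_poly (k + l) x = norm_poly k x * norm_poly l (iter k frob
  x).
Proof.
rewrite /norm_poly big_split_ord /=; congr (_ * _).
by apply: eq_bigr => i _; rewrite addnC iterD.
Qed.

Lemma norm_poly_monic k x : norm_poly k x \is monic.
Proof. exact: monic_prod_XsubC. Qed.

Lemma size_norm_poly k x : size (norm_poly k x) = k.+1.
Proof.
by rewrite /norm_poly size_prod_XsubC /index_enum -enumT size_enum_ord.
Qed.

Lemma map_frob_norm_poly k x : iter k frob x = x ->
  map_poly frob (norm_poly k x) = norm_poly k x.
Proof.
move=> kx; rewrite /norm_poly rmorph_prod /=.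
under eq_bigr => i _ do rewrite rmorphB /= map_polyX map_polyC /= -iterS.
case: k kx => [|k] kx; first by rewrite !big_ord0.
rewrite big_ord_recr big_ord_recl /= -iterS kx mulrC; congr (_ * _).
Qed.

(** The descent of [norm_poly k x] to [F], meaningful when [x] is fixed by the
    [k]-th power of Frobenius. *)
Definition orbit_norm k x : {poly F} := map_poly iota_inv (norm_poly k x).

Lemma iota_inv0 : iota_inv 0 = 0. Proof. by rewrite -(rmorph0 iota) iotaK. Qed.

Lemma map_orbit_norm k x : iter k frob x = x -> map_poly iota (orbit_norm k x) =
  norm_poly k x.
Proof.
move=> kx; apply/polyP => i; rewrite coef_map /= coef_map_id0 ?iota_inv0 //.
by apply: iota_invK; rewrite -[in RHS](map_frob_norm_poly kx) coef_map.
Qed.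

End Frobenius.

(** * Norms dividing a polynomial *)

Lemma sum_bool_count (T : Type) (s : seq T) (P : pred T) :
  (\sum_(x <- s) (P x : nat))%N = count P s.
Proof. by elim: s => [|x s IH]; rewrite ?big_nil // big_cons IH. Qed.

Lemma count_multiples n d m : (0 < d)%N -> (m * d <= n)%N ->
  (\sum_(1 <= k < n.+1) ((d %| k) && (k %/ d <= m) : nat))%N = m.
Proof.
move=> d0 mdn; rewrite sum_bool_count -size_filter -[RHS](size_iota 1 m).
rewrite -[RHS](size_map (fun r => r * d)%N); apply/perm_size/uniq_perm.
- by rewrite filter_uniq ?iota_uniq.
- by rewrite map_inj_uniq ?iota_uniq // => r1 r2 /eqP; rewrite eqn_pmul2r // => /eqP.
move=> k; rewrite mem_filter mem_index_iota; apply/idP/mapP.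
  case/andP=> /andP[/dvdnP[r ->]]; rewrite mulnK // => rm /andP[rd _].
  by exists r; rewrite // mem_iota; case: r rm rd => //= r rm _; rewrite add1n.
case=> r; rewrite mem_iota add1n ltnS => /andP[r0 rm] ->.
rewrite dvdn_mull //= mulnK // rm muln_gt0 r0 d0 ltnS /=.
by apply: leq_trans mdn; rewrite leq_mul.
Qed.

Section OrbitCount.

Variables (F : finFieldType) (K : closedFieldType) (iota : {rmorphism F -> K}).

Local Notation q := #|F|.
Local Notation fr := (frob iota).

Lemma iter_fr_inj i : injective (iter i fr).
Proof. by elim: i => [|i IH] x y //= /fmorph_inj /IH. Qed.

Lemma norm_poly_traject k x : norm_poly iota k x = \prod_(z <- traject fr x k) ('X -
  z%:P).
Proof.
elim: k x => [|k IH] x; first by rewrite /norm_poly big_ord0 big_nil.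
by rewrite -add1n norm_polyD /norm_poly big_ord1 /= big_cons -IH.
Qed.

Variables (G : {poly K}) (n : nat).
Hypotheses (Gm : G \is monic) (sG : size G = n.+1) (frG : map_poly fr G = G).

Let G0 : G != 0. Proof. exact: monic_neq0. Qed.

Lemma dvdp_iter_fr r x i : ('X - x%:P) ^+ r %| G -> ('X - (iter i fr x)%:P) ^+ r %| G.
Proof.
move=> xG; elim: i => [//|i IH].
by move: IH; rewrite -(dvdp_map fr) frG rmorphXn /= rmorphB /= map_polyX map_polyC.
Qed.

Lemma exists_period x : root G x -> exists d, (0 < d)%N && (iter d fr x == x).
Proof.
move=> Gx; have [rs rsE] := closed_field_poly_normal G.
move: rsE; rewrite (monicP Gm) scale1r => rsE.
have srs : size rs = n by move: sG; rewrite rsE size_prod_XsubC => -[].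
(* All conjugates of x are among the n roots of G, so the orbit loops. *)
have sub : {subset traject fr x n.+1 <= rs}.
  move=> _ /trajectP[i _ ->].
  rewrite -root_prod_XsubC -rsE -dvdp_XsubCl -[_ - _]expr1 dvdp_iter_fr //.
  by rewrite expr1 dvdp_XsubCl.
have : ~~ uniq (traject fr x n.+1).
  by apply/negP => /uniq_leq_size /(_ sub); rewrite size_traject srs ltnn.
rewrite looping_uniq negbK => /trajectP[i lin E].
exists (n - i)%N; rewrite subn_gt0 lin; apply/eqP/(@iter_fr_inj i).
by rewrite -iterD subnKC // ltnW.
Qed.

(** If [d] is the size of the Frobenius orbit of [x] and [P] its minimal
    polynomial, then [x] is fixed by the [k]-th power exactly when [d] divides
    [k], and then its norm is [P^(k/d)].  This power divides [G] if and only if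
    [k / d] is at most the multiplicity of [x], because all conjugates of [x] are
    roots of [G] with the same multiplicity. *)
Lemma orbit_count x : root G x ->
  (\sum_(1 <= k < n.+1) ((iter k fr x == x) && (norm_poly iota k x %| G)%R : nat))%N =
    mup x G.
Proof.
move=> Gx; have exd := exists_period Gx.
have [d /andP[d0 /eqP dx] dmin] := ex_minnP exd.
have iter_mul m : iter (m * d) fr x = x.
  by elim: m => [|m IH] //; rewrite mulSn iterD IH.
have per k : (iter k fr x == x) = (d %| k)%N.
  apply/eqP/idP => [|/dvdnP[m ->]]; last exact: iter_mul.
  rewrite {1}(divn_eq k d) addnC iterD iter_mul => kx.
  rewrite /dvdn; apply: contraTT (ltn_pmod k d0) => kd; rewrite -leqNgt.
  by apply: dmin; rewrite lt0n kd kx eqxx.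
have normM m : norm_poly iota (m * d) x = norm_poly iota d x ^+ m.
  elim: m => [|m IH]; first by rewrite mul0n expr0 /norm_poly big_ord0.
  by rewrite mulSn norm_polyD dx IH exprS.
have utr : uniq (traject fr x d).
  case: (d) d0 dmin => // d' _ dmin'; rewrite looping_uniq.
  apply/negP => /trajectP[i lid E].
  have : (d'.+1 <= d' - i)%N.
    apply: dmin'; rewrite subn_gt0 lid; apply/eqP/(@iter_fr_inj i).
    by rewrite -iterD subnKC // ltnW.
  by rewrite leqNgt ltnS leq_subr.
have dvdE r : (norm_poly iota d x ^+ r %| G) = (r <= mup x G)%N.
  rewrite mup_geq //; apply/idP/idP => [H|H].
    apply: dvdp_trans H; apply: dvdp_exp2r.
    rewrite norm_poly_traject; case: (d) d0 => // d' _.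
    by rewrite /= big_cons dvdp_mulIl.
  rewrite norm_poly_traject -prodrXl; apply: dvdp_prod_XsubC_exp => // _ /trajectP[i _
    ->].
  exact: dvdp_iter_fr.
rewrite -[RHS](@count_multiples n d) //.
  apply: eq_bigr => k _; rewrite per; case: (boolP (d %| k)%N) => //= /dvdnP[m ->].
  by rewrite normM dvdE mulnK.
have := dvdp_leq G0 (_ : norm_poly iota d x ^+ mup x G %| G).
rewrite dvdE leqnn -normM size_norm_poly sG => /(_ isT).
by rewrite ltnS.
Qed.

(** The form of unique factorisation behind the Euler product: the degree of [G]
    is the sum of [deg P] over the prime powers [P^r] dividing [G], where each
    [P] is counted through its roots. *)
Lemma norm_poly_count :
  (\sum_(1 <= k < n.+1) \sum_(x <- frob_fixpts F K k) ((norm_poly iota k x %| G)%R :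
    nat))%N = n.
Proof.
have [rs rsE] := closed_field_poly_normal G.
move: rsE; rewrite (monicP Gm) scale1r => rsE.
have srs : size rs = n by move: sG; rewrite rsE size_prod_XsubC => -[].
have memrs x : (x \in rs) = root G x by rewrite rsE root_prod_XsubC.
transitivity (\sum_(1 <= k < n.+1) \sum_(x <- undup rs)
    ((iter k fr x == x) && (norm_poly iota k x %| G)%R : nat))%N.
  apply: eq_big_nat => k /andP[k0 _]; rewrite !sum_bool_count -!size_filter.
  apply/perm_size/uniq_perm; rewrite ?filter_uniq ?undup_uniq ?uniq_frob_fixpts //.
  move=> x; rewrite !mem_filter mem_undup mem_frob_fixpts // iter_frob.
  rewrite andbC -andbA; congr (_ && _).
  case: (boolP (_ %| G)) => //= dv; symmetry; rewrite memrs -dvdp_XsubCl.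
  apply: dvdp_trans dv; rewrite norm_poly_traject; case: (k) k0 => // k' _.
  by rewrite /= big_cons dvdp_mulIl.
rewrite exchange_big /= -[RHS]srs -[RHS]sum1_size -[RHS]big_undup_iterop_count /=.
rewrite [LHS]big_seq [RHS]big_seq; apply: eq_bigr => x.
rewrite mem_undup memrs => /orbit_count ->.
rewrite rsE mu_prod_XsubC; case: (count_mem x rs) => [|c] //.
by rewrite iteropS iter_addn mul1n addn1.
Qed.

End OrbitCount.

(** * Power sums *)

(** Newton's identities.  Adding a factor [1 - w X] changes the right-hand side
    by a telescoping sum. *)
Lemma newton_power_sums (C : comNzRingType) (ws : seq C) n :
  let A := \prod_(w <- ws) (1 - w *: 'X) in
  A`_n *+ n = - \sum_(1 <= k < n.+1) (\sum_(w <- ws) w ^+ k) * A`_(n - k).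
Proof.
elim: ws n => [|w ws IH] n /=.
  rewrite big_nil coef1; under eq_bigr => k _ do rewrite big_nil mul0r.
  by rewrite big1 // oppr0; case: n => [|n]; rewrite ?mulr0n //= mul0rn.
move: IH; rewrite big_cons; set A := \prod_(j <- ws) _ => IH.
have coefE k : ((1 - w *: 'X) * A)`_k = A`_k - w * (if k is k'.+1 then A`_k' else 0).
  rewrite mulrBl mul1r -scalerAl coefB coefZ coefXM.
  by case: k.
under eq_bigr => k _ do rewrite big_cons mulrDl.
rewrite big_split /=.
case: n => [|n]; first by rewrite !big_geq // mulr0n addr0 oppr0.
have -> : \sum_(1 <= k < n.+2) w ^+ k * ((1 - w *: 'X) * A)`_(n.+1 - k) = w * A`_n.
  (* The k-th summand is T k - T k.+1. *)
  pose T k := if (k < n.+2)%N then w ^+ k * A`_(n.+1 - k) else 0.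
  rewrite (eq_big_nat _ _ (F2 := fun k => - (T k.+1 - T k))) => [|k /andP[k0 kn]].
    by rewrite sumrN telescope_sumr // /T ltnn /= sub0r opprK expr1 subSS subn0.
  rewrite coefE opprB /T kn mulrBr; congr (_ - _).
  rewrite ltnS; case: ltnP => kn'; last first.
    have -> : (n.+1 - k = 0)%N by lia.
    by rewrite !mulr0.
  have -> : (n.+1 - k = (n - k).+1)%N by lia.
  by rewrite subSS exprSr mulrA.
have -> : \sum_(1 <= k < n.+2) (\sum_(j <- ws) j ^+ k) * ((1 - w *: 'X) * A)`_(n.+1 - k)
   = - A`_n.+1 *+ n.+1 + w * A`_n *+ n.
  transitivity (\sum_(1 <= k < n.+2) (\sum_(j <- ws) j ^+ k) * A`_(n.+1 - k)
    - w * \sum_(1 <= k < n.+1) (\sum_(j <- ws) j ^+ k) * A`_(n - k)).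
    rewrite [X in X = _]big_nat_recr //= [X in _ = X - _]big_nat_recr //= subnn.
    rewrite coefE mulr0 subr0 addrAC; congr (_ + _).
    rewrite mulr_sumr -sumrB; apply: eq_big_nat => k /andP[k0 kn].
    rewrite coefE; have -> : (n.+1 - k = (n - k).+1)%N by lia.
    by rewrite mulrBr mulrCA.
  rewrite -[X in X - _]opprK -IH; congr (_ + _); first by rewrite mulNrn.
  by rewrite -mulrN -IH mulrnAr.
rewrite coefE mulrnBl opprD opprD mulNrn opprK addrCA; congr (_ + _).
by rewrite -opprD -mulrS.
Qed.

Lemma newton_unique (C : comNzRingType) (c s s' : nat -> C) : c 0%N = 1 ->
  (forall n, \sum_(1 <= k < n.+1) s k * c (n - k)%N = \sum_(1 <= k < n.+1) s' k * c (n -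
    k)%N) ->
  forall n, (0 < n)%N -> s n = s' n.
Proof.
move=> c0 E n; have [N] := ubnP n; elim: N n => // N IH n nN n0.
have := E n; rewrite !big_nat_recr //= subnn c0 !mulr1.
rewrite (eq_big_nat _ _ (F2 := fun k => s' k * c (n - k)%N)) => [|k /andP[k0 kn]].
  by move/addrI.
by rewrite IH //; lia.
Qed.

(** Bernoulli's inequality applied to [x / R]. *)
Lemma power_le_geometric (x R c d : algC) (N0 : nat) : 0 <= x -> 0 <= R -> 0 < c ->
  (forall k, (N0 <= k)%N -> c * x ^+ k <= d * R ^+ k) -> x <= R.
Proof.
move=> x0 R0 c0 H; rewrite real_leNgt ?ger0_real //; apply/negP => Rx.
have xp : 0 < x by apply: le_lt_trans Rx.
have [Rz|Rn] := eqVneq R 0.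
  have := H N0.+1 (leqnSn _); rewrite Rz expr0n /= mulr0.
  by rewrite lt_geF // mulr_gt0 // exprn_gt0.
have Rp : 0 < R by rewrite lt_def Rn.
pose t := x / R; have t1 : 1 < t by rewrite ltr_pdivlMr ?mul1r.
have tk k : (N0 <= k)%N -> t ^+ k <= d / c.
  move/H; rewrite mulrC -ler_pdivlMr // mulrAC => H'.
  by rewrite expr_div_n ler_pdivrMr ?exprn_gt0.
have bern k : 1 + (t - 1) *+ k <= t ^+ k.
  elim: k => [|k IH]; first by rewrite mulr0n addr0 expr0.
  rewrite exprS mulrSr addrA -[X in _ <= X * _](subrKC 1) mulrDl mul1r.
  by rewrite lerD // ler_peMr ?subr_ge0 ?exprn_ege1 // ltW.
have dc : 0 <= d / c by apply: le_trans (tk N0 (leqnn _)); rewrite exprn_ge0 // divr_ge0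
  // ltW.
pose y := d / c / (t - 1).
have y0 : 0 <= y by rewrite divr_ge0 // subr_ge0 ltW.
have := archi_boundP y0; rewrite ltr_pdivrMr ?subr_gt0 // mulr_natl.
pose k := (N0 + Num.bound y)%N => lt1.
suff : d / c < t ^+ k by move/lt_geF; rewrite tk // leq_addr.
apply: lt_le_trans (bern k); apply: lt_le_trans lt1 _.
rewrite -[X in X <= _]add0r lerD // -!(mulr_natr (t - 1)) ler_wpM2l ?ler_nat ?leq_addl //.
by rewrite subr_ge0 ltW.
Qed.

(** A linear combination of consecutive power sums, whose coefficients are those
    of a polynomial vanishing at all [w] other than [w1], isolates
    [w1 ^+ k]; hence a bound on the power sums bounds each term. *)
Lemma power_sums_bound (ws : seq algC) (R c : algC) (N0 : nat) : 0 <= R ->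
  (forall k, (N0 <= k)%N -> `|\sum_(w <- ws) w ^+ k| <= c * R ^+ k) ->
  {in ws, forall w, `|w| <= R}.
Proof.
move=> R0 H w1 w1s.
pose A := \prod_(z <- [seq z <- ws | z != w1]) ('X - z%:P).
have Aw1 : A.[w1] != 0.
  by rewrite -rootE root_prod_XsubC mem_filter eqxx.
have Aw w : w \in ws -> w != w1 -> A.[w] = 0.
  by move=> ww wn; apply/eqP; rewrite -rootE root_prod_XsubC mem_filter wn.
pose m := count_mem w1 ws.
have m0 : (0 < m)%N by rewrite /m -has_count has_pred1.
have key k : \sum_(j < size A) A`_j * (\sum_(w <- ws) w ^+ (k + j)) = w1 ^+ k * A.[w1] *+
  m.
  under eq_bigr => j _ do rewrite mulr_sumr.
  rewrite exchange_big /=.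
  transitivity (\sum_(w <- ws) w ^+ k * A.[w]).
    apply: eq_bigr => w _; rewrite horner_coef mulr_sumr; apply: eq_bigr => j _.
    by rewrite exprD mulrCA.
  rewrite /m -sum1_count -sumrMnr big_seq [RHS]big_mkcond /= [RHS]big_seq.
  apply: eq_bigr => w ww; have [->|wn] := eqVneq w w1; first by rewrite mulr1n.
  by rewrite Aw // mulr0.
apply: (@power_le_geometric _ _ (`|A.[w1]| *+ m) (\sum_(j < size A) `|A`_j| * (c * R ^+
  j)) N0) => //.
  by rewrite pmulrn_lgt0 ?normr_gt0.
move=> k kN.
rewrite mulrnAl mulrC -normrX -normrM -normrMn -key.
apply: le_trans (ler_norm_sum _ _ _) _; rewrite mulr_suml; apply: ler_sum => j _.
rewrite normrM -mulrA ler_wpM2l //.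
apply: le_trans (H _ _) _; first by rewrite (leq_trans kN) ?leq_addr.
by rewrite exprD [R ^+ k * _]mulrC mulrA.
Qed.

(** * The L-function of a product of characters *)

Section LFunction.

Variables (F : finFieldType) (K : closedFieldType) (iota : {rmorphism F -> K}).
Variables (h : nat) (b : 'I_h -> F) (chi : 'I_h -> F -> algC).
Hypothesis b_inj : injective b.
Hypothesis chi1 : forall i, chi i 1 = 1.
Hypothesis chiM : forall i x y, chi i (x * y) = chi i x * chi i y.

Local Notation q := #|F|.
Local Notation char_eval := (char_eval b chi).
Local Notation Lcoef := (Lcoef b chi).

Definition frob_sum k : algC := \sum_(x <- frob_fixpts F K k) char_eval (orbit_norm iota
  k x).

Lemma orbit_norm_monic k x : iter k (frob iota) x = x -> orbit_norm iota k x \is monic.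
Proof. by move=> kx; rewrite -(map_monic iota) map_orbit_norm // norm_poly_monic. Qed.

Lemma size_orbit_norm k x : iter k (frob iota) x = x -> size (orbit_norm iota k x) = k.+1.
Proof. by move=> kx; rewrite -(size_map_poly iota) map_orbit_norm // size_norm_poly. Qed.

(** The logarithmic derivative of the Euler product: count the pairs of a monic
    [g] of degree [n] and an [x] whose norm divides [g] in two ways.
    [norm_poly_count] gives [n] for each [g], while [g = norm * g'] gives the
    right-hand side. *)
Lemma Lcoef_newton n : Lcoef n *+ n = \sum_(1 <= k < n.+1) frob_sum k * Lcoef (n - k).
Proof.
rewrite /Lcoef -sumrMnl.
transitivity (\sum_(g <- monics F n) \sum_(1 <= k < n.+1) \sum_(x <- frob_fixpts F K k)
    if orbit_norm iota k x %| g then char_eval g else 0).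
  rewrite big_seq [RHS]big_seq; apply: eq_bigr => g; rewrite mem_monics => /andP[gm /eqP
    sg].
  have frg : map_poly (frob iota) (map_poly iota g) = map_poly iota g.
    by apply/polyP => i; rewrite !coef_map /= frob_iota.
  have gm' : map_poly iota g \is monic by rewrite map_monic.
  have sg' : size (map_poly iota g) = n.+1 by rewrite size_map_poly.
  rewrite -{1}(norm_poly_count gm' sg' frg) -sumrMnr.
  apply: eq_big_nat => k /andP[k0 _]; rewrite -sumrMnr.
  rewrite big_seq [RHS]big_seq; apply: eq_bigr => x; rewrite mem_frob_fixpts //
    -(iter_frob iota) => /eqP kx.
  by rewrite -map_orbit_norm // dvdp_map mulrb.
rewrite exchange_big /=; apply: eq_big_nat => k /andP[k0 kn].
rewrite exchange_big /= /frob_sum mulr_suml big_seq [RHS]big_seq; apply: eq_bigr => x.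
rewrite mem_frob_fixpts // -(iter_frob iota) => /eqP kx.
rewrite -big_mkcond -big_filter (perm_big _ (monics_dvd (orbit_norm_monic kx)
  (size_orbit_norm kx) _)) //=.
rewrite big_map mulr_sumr; apply: eq_bigr => g _.
by rewrite char_evalM.
Qed.

Variables (i0 : 'I_h) (u : F).
Hypotheses (chiu : chi i0 u != 1) (u0 : u != 0).

(** The L-function is a polynomial of degree less than [h] with constant term 1. *)
Lemma L_inverse_roots : exists ws : seq algC, (size ws <= h.-1)%N /\
  forall n, Lcoef n = (\prod_(w <- ws) (1 - w *: 'X))`_n.
Proof.
pose A : {poly algC} := \poly_(n < h) Lcoef n.
have AE n : A`_n = Lcoef n.
  rewrite coef_poly; case: ltnP => // hn.
  by rewrite (Lcoef_vanish b_inj chiM chiu u0 hn).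
have h0 : (0 < h)%N by apply: leq_ltn_trans (ltn_ord i0).
have A0 : A`_0 = 1 by rewrite AE Lcoef0.
have Anz : A != 0 by apply: contra_eq_neq A0 => ->; rewrite coef0 eq_sym oner_neq0.
have [rs rsE] := closed_field_poly_normal A.
have r0 : {in rs, forall z, z != 0}.
  move=> z zr; apply: contra_eq_neq A0 => z0.
  have : root A z by rewrite rsE rootZ ?lead_coef_eq0 // root_prod_XsubC.
  by rewrite z0 rootE horner_coef0 => /eqP ->; rewrite eq_sym oner_neq0.
exists [seq z^-1 | z <- rs]; split.
  have := size_poly h Lcoef; rewrite -/A rsE size_scale ?lead_coef_eq0 //.
  by rewrite size_prod_XsubC => srs; rewrite size_map -ltnS prednK.
have AP : A = lead_coef A * \prod_(z <- rs) (- z) *: \prod_(w <- [seq z^-1 | z <- rs]) (1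
  - w *: 'X).
  rewrite {1}rsE -scalerA; congr (_ *: _); rewrite big_map.
  elim: rs r0 {rsE} => [|z rs IH] r0; first by rewrite !big_nil scale1r.
  rewrite !big_cons IH => [|y yr]; last by apply: r0; rewrite inE yr orbT.
  have -> : 'X - z%:P = (- z) *: (1 - z^-1 *: 'X).
    by rewrite scalerBr scalerA mulNr mulfV ?r0 ?mem_head // scaleN1r opprK scaleNr
      alg_polyC addrC.
  by rewrite -scalerAl -scalerAr scalerA.
have c1 : lead_coef A * \prod_(z <- rs) (- z) = 1.
  have := A0; rewrite {1}AP coefZ => cA; rewrite -[RHS]cA -[LHS]mulr1; congr (_ * _).
  rewrite -horner_coef0 horner_prod big_map big1 // => z _.
  by rewrite !hornerE ?mulr0 ?subr0.
by move=> n; rewrite -AE {1}AP c1 scale1r.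
Qed.

(** Only the growth rate of the sums over the fields with [q^(2k)] elements
    matters: it bounds the inverse roots [w] by [sqrt q], whatever the constant,
    and the sum over [F] is minus the sum of these at most [h - 1] numbers.
    Even exponents keep [q ^ k], the square root of the field size, an
    integer. *)
Lemma L_bound (c : algC) (N0 : nat) :
    (forall k, (N0 <= k)%N -> `|frob_sum (2 * k)| <= c * q%:R ^+ k) ->
  `|Lcoef 1| <= (h.-1)%:R * sqrtC q%:R.
Proof.
move=> Hc; have [ws [sws wsE]] := L_inverse_roots.
have psum n : (0 < n)%N -> frob_sum n = - \sum_(w <- ws) w ^+ n.
  move: n; apply: (@newton_unique _ Lcoef); first exact: Lcoef0.
  move=> n; rewrite -Lcoef_newton wsE newton_power_sums.
  by rewrite -sumrN; apply: eq_bigr => k _; rewrite wsE mulNr.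
(* Only the even power sums are controlled: they are the power sums of the
   squares. *)
have bw : {in [seq w ^+ 2 | w <- ws], forall w, `|w| <= q%:R}.
  apply: (@power_sums_bound _ _ c N0.+1) => [|k kN]; first exact: ler0n.
  apply: le_trans (Hc k (ltnW kN)).
  rewrite psum ?muln_gt0 ?(leq_trans _ kN) // normrN big_map.
  by under eq_bigr => w _ do rewrite -exprM.
have -> : Lcoef 1 = - \sum_(w <- ws) w.
  by have := Lcoef_newton 1; rewrite big_nat1 subnn Lcoef0 // mulr1 mulr1n psum // => ->.
rewrite normrN; apply: le_trans (ler_norm_sum _ _ _) _.
apply: (@le_trans _ _ (\sum_(w <- ws) sqrtC q%:R)).
  rewrite big_seq [leRHS]big_seq; apply: ler_sum => w ww.
  rewrite -(@ler_pXn2r _ 2) ?nnegrE ?sqrtC_ge0 ?ler0n // sqrtCK -normrX.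
  by apply: bw; apply: map_f.
rewrite big_const_seq count_predT iter_addr_0 -[X in X <= _]mulr_natl ler_wpM2r
  ?sqrtC_ge0 ?ler0n //.
by rewrite ler_nat.
Qed.

End LFunction.

(** * Multiplicative characters of order [e] *)

Lemma mup_split_poly (K : fieldType) h (b : 'I_h -> K) (a : 'I_h -> nat) i :
  injective b -> mup (b i) (split_poly b a) = a i.
Proof.
move=> b_inj; rewrite /split_poly (bigD1 i) //= mupMl; last first.
  rewrite rootE horner_prod; apply/prodf_neq0 => k ki.
  by rewrite horner_exp expf_neq0 // !hornerE subr_eq0 (inj_eq b_inj).
rewrite mup_exp; last by rewrite -size_poly_gt0 size_linp.
rewrite /linp -opprB -mulN1r -polyC1 -polyCN mupMr ?rootC ?oppr_eq0 ?oner_neq0 //.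
by rewrite -[_ - _]expr1 mup_XsubCX eqxx muln1.
Qed.

Lemma leq_pred_add s1 s2 m1 m2 :
  (s1 <= m1.+1)%N -> (s2 <= m2.+1)%N -> ((s1 + s2).-1 <= (m1 + m2).+1)%N.
Proof. lia. Qed.

Lemma size_split_poly (K : fieldType) h (b : 'I_h -> K) (a : 'I_h -> nat) :
  (size (split_poly b a) <= (\sum_i a i).+1)%N.
Proof.
rewrite /split_poly; elim/big_rec2: _ => [|i m p _ IH]; first by rewrite size_poly1.
apply: leq_trans (size_polyMleq _ _) _.
have s1 := size_poly_exp_leq (linp (b i)) (a i); rewrite size_linp mul1n in s1.
by apply: leq_trans (leq_pred_add s1 IH) _.
Qed.

Lemma expf_card_pred (F : finFieldType) (x : F) : x != 0 -> x ^+ #|F|.-1 = 1.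
Proof.
move=> x0; apply: (mulfI x0); rewrite -exprS prednK ?mulr1 ?expf_card //.
by apply/card_gt0P; exists 0.
Qed.

Lemma finField_prim_root (F : finFieldType) :
  exists g : F, (#|F|.-1).-primitive_root g.
Proof.
have q1 : (0 < #|F|.-1)%N by have := finNzRing_gt1 F; case: #|F| => [|[|]].
have : has (#|F|.-1).-primitive_root (enum [pred x : F | x != 0]).
  apply: has_prim_root; rewrite ?enum_uniq //.
    apply/allP => x; rewrite mem_enum inE => x0.
    by rewrite unity_rootE expf_card_pred.
  by rewrite -cardE -(cardC1 (0 : F)); apply: eq_leq; exact: eq_card.
by case/hasP => g _ gprim; exists g.
Qed.

Section DiscreteLog.

Variables (F : finFieldType) (e : nat) (zeta : F) (z : algC).
Hypotheses (zeta_prim : e.-primitive_root zeta) (z_prim : e.-primitive_root z).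

(** The isomorphism from the [e]-th roots of unity of [F] to those of [algC] that
    sends [zeta] to [z]. *)
Definition mu_iso (y : F) : algC := 
  z ^+ (if [pick i : 'I_e | y == zeta ^+ i] is Some i then i : nat else 0%N).

Lemma mu_isoE j : mu_iso (zeta ^+ j) = z ^+ j.
Proof.
rewrite /mu_iso; case: pickP => [i /eqP E|H].
  apply/eqP; rewrite (eq_prim_root_expr z_prim) eq_sym.
  by rewrite -(eq_prim_root_expr zeta_prim) E.
have jy : (zeta ^+ j) ^+ e = 1 by rewrite exprAC (prim_expr_order zeta_prim) expr1n.
by have [i E] := prim_rootP zeta_prim jy; have := H i; rewrite E eqxx.
Qed.

Lemma mu_isoM x y : x ^+ e = 1 -> y ^+ e = 1 -> mu_iso (x * y) = mu_iso x * mu_iso y.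
Proof.
move=> /(prim_rootP zeta_prim)[i ->] /(prim_rootP zeta_prim)[j ->].
by rewrite -exprD !mu_isoE exprD.
Qed.

Lemma mu_iso1 : mu_iso 1 = 1. Proof. by rewrite -(expr0 zeta) mu_isoE. Qed.

Lemma mu_iso_prod (I : finType) (f : I -> F) (a : I -> nat) : (forall i, f i ^+ e = 1) ->
  mu_iso (\prod_i f i ^+ a i) = \prod_i mu_iso (f i) ^+ a i.
Proof.
move=> fe; suff [] : mu_iso (\prod_i f i ^+ a i) = \prod_i mu_iso (f i) ^+ a i /\
   (\prod_i f i ^+ a i) ^+ e = 1 by [].
elim/big_rec2: _ => [|i y x _ [E xe]]; first by rewrite mu_iso1 expr1n.
have fae : (f i ^+ a i) ^+ e = 1 by rewrite exprAC fe expr1n.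
split; last by rewrite exprMn fae xe mulr1.
rewrite mu_isoM // E; congr (_ * _).
by have [j ->] := prim_rootP zeta_prim (fe i); rewrite -exprM !mu_isoE exprM.
Qed.

Hypothesis e_dvd : (e %| #|F|.-1)%N.

(** [kappa] takes values in the [e]-th roots of unity, and its fibres on nonzero
    elements are the cyclotomic classes of order [e]. *)
Definition kappa (x : F) : F := x ^+ (#|F|.-1 %/ e).

Lemma kappaM x y : kappa (x * y) = kappa x * kappa y.
Proof. exact: exprMn. Qed.

Lemma kappa1 : kappa 1 = 1. Proof. exact: expr1n. Qed.

Lemma kappa_exp x : x != 0 -> kappa x ^+ e = 1.
Proof. by move=> x0; rewrite /kappa -exprM divnK // expf_card_pred. Qed.

Definition mchar (x : F) : algC := if x == 0 then 0 else mu_iso (kappa x).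

Lemma mchar1 : mchar 1 = 1.
Proof. by rewrite /mchar oner_eq0 kappa1 mu_iso1. Qed.

Lemma mcharM x y : mchar (x * y) = mchar x * mchar y.
Proof.
rewrite /mchar mulf_eq0; have [->|x0] := eqVneq x 0; first by rewrite /= mul0r.
have [->|y0] := eqVneq y 0; first by rewrite /= mulr0.
by rewrite /= kappaM mu_isoM ?kappa_exp.
Qed.

Lemma kappa_surj w : w ^+ e = 1 -> exists2 x, x != 0 & kappa x = w.
Proof.
move=> we; have [g gprim] := finField_prim_root F.
have [i ->] := prim_rootP (dvdn_prim_root gprim e_dvd : e.-primitive_root (kappa g)) we.
exists (g ^+ i); last by rewrite /kappa exprAC.
rewrite expf_neq0 // (prim_root_eq0 gprim) -lt0n.
exact: prim_order_gt0 gprim.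
Qed.

Lemma mchar_nontriv a : (0 < a < e)%N -> exists2 u, u != 0 & mchar u ^+ a != 1.
Proof.
case/andP=> a0 ae; have [u u0 ku] := kappa_surj (prim_expr_order zeta_prim).
exists u => //; rewrite /mchar (negPf u0) ku -[zeta]expr1 mu_isoE expr1.
by rewrite -(prim_order_dvd z_prim) gtnNdvd.
Qed.

End DiscreteLog.

(** * Character sums over extension fields *)

(** Parameters for [Q = P^2]: [L = P], [D] about [Q / e] and [J = P / e + h + 3]
    roughly.  The surplus [h + 3] in [J] gives about [(h + 3) Q] coefficients more
    than the main term [P D] of the number of conditions, against the
    [P J + h Q] others. *)
Lemma stepanov_room e h m P M D J :
  (0 < e)%N -> (P * P = (M * e).+1)%N -> (D + m = M)%N -> (J * e = P.-1 + e * (h + 3))%N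
    ->
  ((h + 2) * (1 + e * m) + h + 5 <= P)%N ->
  (P * (D + J + P * h) < e * J * D)%N.
Proof.
move=> e0 PM DM JE HP.
have P0 : (0 < P)%N by lia.
have JP : (J <= P + h + 3)%N.
  by rewrite -(leq_pmul2r e0) JE; have := leq_pmulr P e0; lia.
have eD : (e * D + e * m + 1 = P * P)%N by rewrite PM -DM; lia.
set c := ((h + 2) * (1 + e * m))%N in HP.
have cE : ((h + 2) * (e * D) + c = (h + 2) * (P * P))%N by rewrite -eD /c; lia.
have PP : (c * P + (h + 5) * P <= P * P)%N by rewrite -mulnDl leq_pmul2r //; lia.
have cP := leq_pmulr c P0.
have PJ : (P * J <= P * (P + h + 3))%N by rewrite leq_pmul2l.
set E := (e * (h + 3) - 1)%N.
have E1 : ((h + 2) * e <= E)%N by rewrite /E; lia.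
have ED : ((h + 2) * (e * D) <= E * D)%N by rewrite mulnA leq_mul.
have -> : (e * J * D = (P + E) * D)%N.
  by rewrite [(e * J)%N]mulnC JE /E; congr (_ * _)%N; lia.
move: ED cE PP cP PJ; move: c E E1 HP {JE JP eD PM DM} => c E _ _.
lia.
Qed.

Section FrobeniusSums.

Variables (F : finFieldType) (K : closedFieldType) (iota : {rmorphism F -> K}).
Variables (h : nat) (b : 'I_h -> F) (a : 'I_h -> nat).
Variables (e : nat) (zeta : F) (z : algC).
Hypothesis b_inj : injective b.
Hypotheses (zeta_prim : e.-primitive_root zeta) (z_prim : e.-primitive_root z).
Hypotheses (e_gt1 : (1 < e)%N) (e_dvd : (e %| #|F|.-1)%N).
Hypothesis a_gt0 : forall i, (0 < a i)%N.
Hypothesis a_prim : forall s, (0 < s < e)%N -> exists i, ~~ (e %| s * a i)%N.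

Local Notation q := #|F|.
Local Notation chi := (fun i x => mchar e zeta z x ^+ a i).
Local Notation be := (fun i => iota (b i)).
Local Notation f := (split_poly be a).

Let e_gt0 : (0 < e)%N. Proof. exact: ltnW. Qed.

Lemma card_pred_exp n : (q ^ n).-1 = (q.-1 * \sum_(j < n) q ^ j)%N.
Proof. by rewrite predn_exp. Qed.

Lemma horner_norm_poly n c x :
  (norm_poly iota n x).[iota c] = (iota c - x) ^+ (\sum_(j < n) q ^ j).
Proof.
rewrite /norm_poly horner_prod expr_sum; apply: eq_bigr => j _.
rewrite hornerXsubC -(iter_frob iota).
by elim: (j : nat) => [//|i /= <-]; rewrite rmorphB /= frob_iota.
Qed.

(** Raising to the power [(q^n - 1) / (q - 1)] is the norm to [F], so the
    characters of the field with [q ^ n] elements obtained by lifting those of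
    [F] are again given by a power [(q^n - 1) / e]. *)
Lemma char_eval_orbit_norm n x : (0 < n)%N -> x \in frob_fixpts F K n ->
  char_eval b chi (orbit_norm iota n x) =
    if f.[x] == 0 then 0 else mu_iso e zeta z (iota_inv iota (f.[x] ^+ ((q ^ n).-1 %/
      e))).
Proof.
move=> n0; rewrite mem_frob_fixpts // -(iter_frob iota) => /eqP nx.
have val i : iota ((orbit_norm iota n x).[b i]) = (iota (b i) - x) ^+ (\sum_(j < n) q ^
  j).
  by rewrite -horner_map map_orbit_norm // horner_norm_poly.
have S0 : (0 < \sum_(j < n) q ^ j)%N.
  by case: (n) n0 => // n' _; rewrite big_ord_recl expn0.
have val0 i : ((orbit_norm iota n x).[b i] == 0) = (iota (b i) - x == 0).
  by rewrite -(fmorph_eq0 iota) val expf_eq0 S0.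
have fE : f.[x] = \prod_i (iota (b i) - x) ^+ a i.
  by rewrite horner_prod; apply: eq_bigr => i _; rewrite horner_exp /linp !hornerE.
rewrite /char_eval; case: eqP => [|/eqP].
  rewrite fE => /eqP/prodf_eq0[i _]; rewrite expf_eq0 => /andP[_ bx].
  rewrite (bigD1 i) //= /mchar val0 bx expr0n.
  by rewrite eqn0Ngt a_gt0 mul0r.
rewrite fE => /prodf_neq0 nz.
have nz' i : (orbit_norm iota n x).[b i] != 0.
  by rewrite val0; have := nz i isT; rewrite expf_eq0 a_gt0.
transitivity (\prod_i mu_iso e zeta z (kappa e (orbit_norm iota n x).[b i]) ^+ a i).
  by apply: eq_bigr => i _; rewrite /mchar (negPf (nz' i)).
rewrite -(mu_iso_prod zeta_prim z_prim) => [|i]; last by rewrite kappa_exp.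
congr mu_iso; apply: esym; rewrite -[RHS](iotaK iota); congr iota_inv.
rewrite rmorph_prod /= -prodrXl; apply: eq_bigr => i _.
rewrite rmorphXn /= /kappa rmorphXn /= val -!exprM; congr (_ ^+ _).
by rewrite card_pred_exp [(q.-1 * _)%N]mulnC -muln_divA // mulnCA [(a i * _)%N]mulnC.
Qed.

(** Where the product of the lifted characters takes the value [z ^+ j]. *)
Definition level_set n j := [seq x <- frob_fixpts F K n |
  (f.[x] != 0) && (f.[x] ^+ ((q ^ n).-1 %/ e) == iota (zeta ^+ j))].

Lemma frob_fixpts_non_root n : (0 < n)%N -> (h < q ^ n)%N ->
  exists x0, x0 \in frob_fixpts F K n /\ f.[x0] != 0.
Proof.
move=> n0 hq; case: (boolP (all (fun x => f.[x] == 0) (frob_fixpts F K n))) => [/allP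
  al|].
  have sub : {subset frob_fixpts F K n <= [seq be i | i : 'I_h]}.
    move=> x /al; rewrite horner_prod => /prodf_eq0[i _].
    rewrite horner_exp expf_eq0 /linp !hornerE subr_eq0 => /andP[_ /eqP <-].
    by apply/mapP; exists i; rewrite ?mem_enum.
  have := uniq_leq_size (uniq_frob_fixpts iota n0) sub.
  by rewrite size_frob_fixpts // size_map size_enum_ord leqNgt hq.
by rewrite -has_predC => /hasP[x xs /= fx]; exists x.
Qed.

Lemma level_set_bound k j (m := (\sum_i a i)%N) :
  ((h + 2) * (1 + e * m) + h + 5 <= q ^ k)%N ->
  (e * size (level_set (2 * k) j) <= q ^ (2 * k) + e * (h + 3 + m) * q ^ k)%N.
Proof.
set P := (q ^ k)%N => HP.
have [k0|k0] := posnP k; first by move: HP; rewrite /P k0 expn0; lia.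
set n := (2 * k)%N; have n0 : (0 < n)%N by rewrite muln_gt0.
set Q := (q ^ n)%N; have QE : Q = (P * P)%N by rewrite /Q /n mul2n -addnn expnD.
set M := (Q.-1 %/ e)%N.
have ePr : (e %| P.-1)%N by rewrite /P card_pred_exp dvdn_mulr.
have eQ : (e %| Q.-1)%N by rewrite /Q card_pred_exp dvdn_mulr.
have Q0 : (0 < Q)%N by rewrite /Q expn_gt0 (ltnW (finNzRing_gt1 F)).
have QM : Q = (M * e).+1 by rewrite divnK // prednK.
have PQ : (P <= Q)%N by rewrite QE leq_pmulr //; lia.
have hQ : (h < Q)%N by apply: leq_trans PQ; lia.
have [x0 [x0s fx0]] := frob_fixpts_non_root n0 hQ.
pose J := (P.-1 %/ e + (h + 3))%N.
have JE : (J * e = P.-1 + e * (h + 3))%N by rewrite mulnDl divnK // mulnC.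
have mM : (m < M)%N.
  rewrite -(ltn_pmul2r e_gt0); suff : ((m * e).+2 <= Q)%N by rewrite QM.
  by apply: leq_trans PQ; lia.
pose D := (M - m)%N; have DM : (D + m = M)%N by rewrite subnK // ltnW.
have PM : (P * P = (M * e).+1)%N by rewrite -QE.
have room := stepanov_room e_gt0 PM DM JE HP.
have SB : (P * size (level_set n j) <= (J + m) * Q)%N.
  apply: (@stepanov_bound K h be a Q M e e_gt0 QM _ _ _ _ x0 _ fx0 D J P m _ _ _ _ _ _
    (iota (zeta ^+ j))) => //.
  - exact: pnat_pchar_card iota n.
  - move=> i; rewrite -(iter_frob iota); elim: (n : nat) => [//|n' /= ->].
    exact: frob_iota.
  - move=> s /a_prim[i ni]; exists (be i).
    by rewrite (mup_split_poly a i (inj_comp (fmorph_inj iota) b_inj)).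
  - by apply/eqP; rewrite -mem_frob_fixpts.
  - by rewrite subn_gt0.
  - exact: size_split_poly.
  - have D0 : (0 < D)%N by rewrite subn_gt0.
    rewrite QM -DM ltnS; case: (D) D0 => // D' _ /=; case: (e) e_gt0 => // e' _ /=.
    by rewrite mulnDl; lia.
  - by apply: leq_trans (leq_subr _ _) _; rewrite QM leqW // leq_pmulr.
  - by rewrite filter_uniq ?(uniq_frob_fixpts iota).
  - move=> x; rewrite mem_filter mem_frob_fixpts // => /andP[/andP[fx /eqP fxM] /eqP xQ].
    by split.
have P0 : (0 < P)%N by lia.
have T1 : (size (level_set n j) <= (J + m) * P)%N.
  by rewrite -(leq_pmul2l P0); apply: leq_trans SB _; rewrite QE; lia.
have T2 : (e * size (level_set n j) <= e * (J + m) * P)%N by rewrite -mulnA leq_mul.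
apply: leq_trans T2 _.
have -> : (e * (J + m) = P.-1 + e * (h + 3 + m))%N by rewrite mulnDr [(e * J)%N]mulnC JE;
  lia.
by rewrite mulnDl leq_add2r QE leq_mul2r leq_pred orbT.
Qed.

Lemma sum_prim_root : \sum_(j < e) z ^+ j = 0.
Proof.
have z1 : z != 1.
  apply/negP => /eqP E; have := prim_order_dvd z_prim 1.
  by rewrite E expr1 eqxx dvdn1 gtn_eqF.
apply/eqP; rewrite -(mulrI_eq0 _ (mulfI (_ : z - 1 != 0))) ?subr_eq0 //.
by rewrite -subrX1 (prim_expr_order z_prim) subrr.
Qed.

Lemma level_set_cover n : (0 < n)%N ->
  frob_sum iota b chi n = \sum_(j < e) z ^+ j *+ size (level_set n j)
  /\ (q ^ n <= \sum_(j < e) size (level_set n j) + h)%N.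
Proof.
move=> n0.
have eQ : (e %| (q ^ n).-1)%N by rewrite card_pred_exp dvdn_mulr.
have Q0 : (0 < q ^ n)%N by rewrite expn_gt0 (ltnW (finNzRing_gt1 F)).
have key x : x \in frob_fixpts F K n -> f.[x] != 0 ->
    exists j0 : 'I_e, f.[x] ^+ ((q ^ n).-1 %/ e) = iota (zeta ^+ j0) /\
      forall j : 'I_e, (f.[x] ^+ ((q ^ n).-1 %/ e) == iota (zeta ^+ j)) = (j == j0).
  rewrite mem_frob_fixpts // => /eqP xQ fx.
  have fQ : f.[x] ^+ (q ^ n) = f.[x].
    rewrite -(iter_frob iota).
    have -> : iter n (frob iota) f.[x] = f.[iter n (frob iota) x].
      elim: (n) => [//|n' /= ->]; rewrite -horner_map; congr (_.[_]).
      rewrite /split_poly rmorph_prod /=; apply: eq_bigr => i _.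
      by rewrite rmorphXn /= /linp rmorphB /= map_polyC map_polyX /= frob_iota.
    by rewrite iter_frob xQ.
  have f1 : (f.[x] ^+ ((q ^ n).-1 %/ e)) ^+ e = 1.
    by rewrite -exprM divnK //; apply: (mulfI fx); rewrite -exprS prednK // mulr1.
  have ziota : e.-primitive_root (iota zeta) by rewrite fmorph_primitive_root.
  have [j0 E] := prim_rootP ziota f1.
  exists j0; rewrite rmorphXn /=; split=> // j.
  by rewrite E rmorphXn /= (eq_prim_root_expr ziota) !modn_small // eq_sym.
split.
  rewrite /frob_sum.
  transitivity (\sum_(x <- frob_fixpts F K n) \sum_(j < e)
     (if (f.[x] != 0) && (f.[x] ^+ ((q ^ n).-1 %/ e) == iota (zeta ^+ j)) then z ^+ j
       else 0)).
    rewrite big_seq [RHS]big_seq; apply: eq_bigr => x xs.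
    rewrite char_eval_orbit_norm //; case: (eqVneq f.[x] 0) => [_|fx] /=; first by
      rewrite big1.
    have [j0 [E Ej]] := key x xs fx.
    rewrite E iotaK (mu_isoE zeta_prim z_prim) (bigD1 j0) //= -{1}E Ej eqxx big1 ?addr0
      // => j jj.
    by rewrite -E Ej (negPf jj).
  rewrite exchange_big /=; apply: eq_bigr => j _.
  by rewrite -big_mkcond -big_filter big_const_seq count_predT iter_addr_0.
have -> : (\sum_(j < e) size (level_set n j) = count (fun x => (f.[x] != 0)%R)
  (frob_fixpts F K n))%N.
  transitivity (\sum_(j < e) \sum_(x <- frob_fixpts F K n)
      ((f.[x] != 0)%R && (f.[x] ^+ ((q ^ n).-1 %/ e) == iota (zeta ^+ j))%R : nat))%N.
    by apply: eq_bigr => j _; rewrite sum_bool_count size_filter.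
  rewrite exchange_big /= -sum_bool_count big_seq [RHS]big_seq; apply: eq_bigr => x xs.
  case: (eqVneq f.[x] 0) => [_|fx] /=; first by rewrite big1.
  have [j0 [E Ej]] := key x xs fx.
  by rewrite (bigD1 j0) //= Ej eqxx big1 // => j jj; rewrite Ej (negPf jj).
rewrite -(size_frob_fixpts F K n0) -(count_predC (fun x => f.[x] != 0)) leq_add2l
  -size_filter.
apply: (@leq_trans (size [seq be i | i : 'I_h])); last by rewrite size_map size_enum_ord.
apply: uniq_leq_size; first by rewrite filter_uniq ?(uniq_frob_fixpts iota).
move=> x; rewrite mem_filter /= negbK horner_prod => /andP[/prodf_eq0[i _] + _].
rewrite horner_exp expf_eq0 /linp !hornerE subr_eq0 => /andP[_ /eqP <-].
by apply/mapP; exists i; rewrite ?mem_enum.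
Qed.

(** Stepanov's method bounds each level set from above by [Q / e + O(P)], and
    together the level sets exhaust all but [h] points.  As [\sum_j z^j = 0],
    the sum does not change when the sizes are replaced by their defects from
    the upper bound, and the total of these defects is [O(P)]. *)
Lemma frob_sum_bound : exists (c : algC) (N0 : nat), forall k, (N0 <= k)%N ->
  `|frob_sum iota b chi (2 * k)| <= c * q%:R ^+ k.
Proof.
pose m := (\sum_i a i)%N.
pose B := (e * (h + 3 + m))%N.
exists (B + h)%:R, ((h + 2) * (1 + e * m) + h + 5)%N => k kN.
have q1 := finNzRing_gt1 F.
have HP : ((h + 2) * (1 + e * m) + h + 5 <= q ^ k)%N.
  by apply: leq_trans kN _; rewrite ltnW // ltn_expl.
have k0 : (0 < k)%N by apply: leq_trans kN; rewrite addnS.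
set n := (2 * k)%N; have n0 : (0 < n)%N by rewrite muln_gt0.
have [fE cover] := level_set_cover n0.
set W := (q ^ n + B * q ^ k)%N.
have TW j : (e * size (level_set n j) <= W)%N by apply: level_set_bound.
have eS : e%:R * frob_sum iota b chi n = - \sum_(j < e) z ^+ j * (W - e * size (level_set
  n j))%:R.
  rewrite fE mulr_sumr.
  transitivity (\sum_(j < e) (z ^+ j * (e * size (level_set n j))%:R)).
    by apply: eq_bigr => j _; rewrite mulr_natl -mulrnA mulr_natr mulnC.
  apply/eqP; rewrite -addr_eq0 -big_split /=; apply/eqP.
  under eq_bigr => j _ do rewrite -mulrDr -natrD subnKC //.
  by rewrite -mulr_suml sum_prim_root mul0r.
have nz j : `|z ^+ j| = 1.
  have /eqP : `|z| ^+ e = 1 by rewrite -normrX (prim_expr_order z_prim) normr1.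
  by rewrite pexpr_eq1 // normrX => /eqP ->; rewrite expr1n.
have bnd : `|e%:R * frob_sum iota b chi n| <= (\sum_(j < e) (W - e * size (level_set n
  j)))%:R.
  rewrite eS normrN natr_sum; apply: le_trans (ler_norm_sum _ _ _) _.
  by apply: ler_sum => j _; rewrite normrM nz mul1r normr_nat.
have S1 : (\sum_(j < e) (W - e * size (level_set n j)) <= e * ((B + h) * q ^ k))%N.
  rewrite sumnB // sum_nat_const card_ord -big_distrr /=.
  rewrite leq_subLR -mulnDr leq_mul2l; apply/orP; right.
  rewrite /W; have P1 : (1 <= q ^ k)%N by rewrite expn_gt0 (ltnW q1).
  rewrite mulnDl addnCA addnC leq_add2l.
  by apply: leq_trans cover _; rewrite leq_add2l leq_pmulr.
rewrite -natrX -natrM.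
have e0 : 0 < e%:R :> algC by rewrite ltr0n.
rewrite -(ler_pM2l e0) -natrM.
have -> : e%:R * `|frob_sum iota b chi n| = `|e%:R * frob_sum iota b chi n|.
  by rewrite normrM normr_nat.
by apply: le_trans bnd _; rewrite ler_nat.
Qed.

End FrobeniusSums.

(** * The Weil bound for split polynomials *)

(** Lowers the order of the characters when it has a divisor in common with the
    exponents. *)
Lemma mchar_reduce (F : finFieldType) e c (zeta : F) (z : algC) a x :
    (0 < e)%N -> e.-primitive_root zeta -> e.-primitive_root z -> (e %| #|F|.-1)%N ->
    (c %| e)%N -> (c %| a)%N -> (0 < a)%N ->
  mchar e zeta z x ^+ a = mchar (e %/ c) (zeta ^+ c) (z ^+ c) x ^+ (a %/ c).
Proof.
move=> e0 zetaP zP eq ce ca a0.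
have c0 : (0 < c)%N by apply: dvdn_gt0 ce.
have ac0 : (0 < a %/ c)%N by rewrite divn_gt0 // dvdn_leq.
have ece : (e %/ (e %/ c) = c)%N by rewrite divnA // mulKn.
have ec_e : (e %/ c %| e)%N by rewrite -{2}(divnK ce) dvdn_mulr.
have zetaP' := dvdn_prim_root zetaP ec_e; rewrite ece in zetaP'.
have zP' := dvdn_prim_root zP ec_e; rewrite ece in zP'.
rewrite /mchar; have [_|x0] := eqVneq x 0; first by rewrite !expr0n !eqn0Ngt a0 ac0.
have [j kj] := prim_rootP zetaP (kappa_exp eq x0).
have kj' : kappa (e %/ c) x = (zeta ^+ c) ^+ j.
  rewrite exprAC -kj /kappa -exprM; congr (_ ^+ _).
  have [t ->] := dvdnP eq; rewrite mulnK //.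
  have e'0 : (0 < e %/ c)%N by rewrite divn_gt0 // dvdn_leq.
  by rewrite -{1}(divnK ce) mulnCA mulnC mulnK // mulnC.
rewrite kj kj' (mu_isoE zetaP zP) (mu_isoE zetaP' zP') -!exprM; congr (_ ^+ _).
by rewrite -{1}(divnK ca); lia.
Qed.

(** The irreducibility behind Stepanov's method needs exponents [a i] with no
    common divisor with [e]; dividing everything by the greatest one reduces to
    that case. *)
Theorem weil_bound (F : finFieldType) h (b : 'I_h -> F) (a : 'I_h -> nat) e (zeta : F) (z
  : algC) :
    injective b -> (0 < h)%N -> e.-primitive_root zeta -> e.-primitive_root z ->
    (e %| #|F|.-1)%N -> (forall i, 0 < a i < e)%N ->
  `|\sum_x \prod_i mchar e zeta z (b i - x) ^+ a i| <= h.-1%:R * sqrtC #|F|%:R.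
Proof.
move=> b_inj h0 zetaP zP eq ha.
have i0 : 'I_h := Ordinal h0.
have e0 : (0 < e)%N by have /andP[_] := ha i0; apply: leq_trans.
pose c := \big[gcdn/e]_i a i.
have ce : (c %| e)%N.
  by rewrite /c; elim/big_rec: _ => // i d _ dd; apply: dvdn_trans dd; exact: dvdn_gcdr.
have ca i : (c %| a i)%N.
  by rewrite /c (bigD1 i) //=; exact: dvdn_gcdl.
have c0 : (0 < c)%N by apply: dvdn_gt0 ce.
have ece : (e %/ (e %/ c) = c)%N by rewrite divnA // mulKn.
have ec_e : (e %/ c %| e)%N by rewrite -{2}(divnK ce) dvdn_mulr.
have zetaP' := dvdn_prim_root zetaP ec_e; rewrite ece in zetaP'.
have zP' := dvdn_prim_root zP ec_e; rewrite ece in zP'.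
set e' := (e %/ c)%N in zetaP' zP' ec_e *.
pose a' i := (a i %/ c)%N.
have e'q : (e' %| #|F|.-1)%N := dvdn_trans ec_e eq.
have a'0 i : (0 < a' i)%N by have /andP[ai _] := ha i; rewrite divn_gt0 // dvdn_leq.
have a'e i : (a' i < e')%N by have /andP[_ ai] := ha i; rewrite ltn_divLR // divnK.
have e'1 : (1 < e')%N by apply: leq_ltn_trans (a'e i0); exact: a'0.
have a'prim s : (0 < s < e')%N -> exists i, ~~ (e' %| s * a' i)%N.
  case/andP=> s0 se; case: (boolP [forall i, e' %| s * a' i]%N); last first.
    by rewrite negb_forall => /existsP.
  move/forallP => al; have : (e %| s * c)%N.
    rewrite /c; elim/big_rec: _ => [|i d _ dd]; first exact: dvdn_mull.
    rewrite muln_gcdr dvdn_gcd dd andbT -(divnK (ca i)) mulnA -[X in (X %| _)%N](divnK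
      ce).
    by rewrite dvdn_pmul2r //; exact: al.
  rewrite -{1}(divnK ce) dvdn_pmul2r // => /(dvdn_leq s0).
  by rewrite leqNgt se.
have [K [iota _]] := countable_algebraic_closure F.
pose chi (i : 'I_h) (x : F) := mchar e' (zeta ^+ c) (z ^+ c) x ^+ a' i.
have chi1 i : chi i 1 = 1 by rewrite /chi (mchar1 zetaP' zP') expr1n.
have chiM i x y : chi i (x * y) = chi i x * chi i y.
  by rewrite /chi (mcharM zetaP' zP' e'q) exprMn.
have [u u0 chiu] : exists2 u, u != 0 & mchar e' (zeta ^+ c) (z ^+ c) u ^+ a' i0 != 1.
  by apply: mchar_nontriv; rewrite // a'0 a'e.
have [C [N0 HC]] := frob_sum_bound iota b_inj zetaP' zP' e'1 e'q a'0 a'prim.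
have := L_bound b_inj chi1 chiM chiu u0 HC.
rewrite Lcoef1; congr (`|_| <= _).
apply: eq_bigr => x _; apply: eq_bigr => i _.
by rewrite /chi -mchar_reduce //; have /andP[] := ha i.
Qed.

(** * Elements with prescribed cyclotomic classes *)

(** [Q_bound R d m] is the square of the positive root of
    [T^2 - U T - d^(m-1) m], so the hypothesis says that this polynomial is
    positive at [sqrt q].  In terms of natural numbers it no longer mentions
    [R]. *)
Lemma Q_bound_nat (R : rcfType) d m q : Q_bound R d m < q%:R ->
  (d ^ m.-1 * m < q)%N /\ (U_bound d m ^ 2 * q < (q - d ^ m.-1 * m) ^ 2)%N.
Proof.
rewrite /Q_bound; set c := (d ^ m.-1 * m)%N; set U := U_bound d m.
set s := Num.sqrt _ => hs.
have arg0 : 0 <= U%:R ^+ 2 + 4 * d%:R ^+ m.-1 * m%:R :> R.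
  by rewrite addr_ge0 ?exprn_ge0 ?mulr_ge0 ?ler0n ?exprn_ge0 ?ler0n.
have s2 : s ^+ 2 = U%:R ^+ 2 + 4 * c%:R by rewrite sqr_sqrtr // /c natrM natrX mulrA.
have s0 : 0 <= s by exact: sqrtr_ge0.
have U0 : 0 <= U%:R :> R by exact: ler0n.
have Us : U%:R <= s.
  by rewrite -(@ler_pXn2r _ 2) // s2 lerDl mulr_ge0 ?ler0n.
pose r : R := Num.sqrt q%:R.
have r2 : r ^+ 2 = q%:R by rewrite sqr_sqrtr ?ler0n.
have r0 : 0 <= r by exact: sqrtr_ge0.
pose t := (U%:R + s) / 2.
have t0 : 0 <= t by rewrite divr_ge0 ?addr_ge0 ?ler0n.
(* t is the positive root of T^2 - U T - c. *)
have tr : t < r.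
  rewrite -(@ltr_pXn2r _ 2) // r2; apply: le_lt_trans hs.
  by rewrite le_eqVlt; apply/orP; left; apply/eqP; rewrite /t; field.
have t2 : t ^+ 2 = U%:R * t + c%:R.
  have -> : t ^+ 2 = (U%:R ^+ 2 + 2 * U%:R * s + s ^+ 2) / 4 by rewrite /t; field.
  by rewrite s2 /t; field.
have key : U%:R * r + c%:R < q%:R.
  have : 0 < (r - t) * (r + t - U%:R).
    have tU : U%:R <= t by rewrite /t ler_pdivlMr ?ltr0n // mulr_natr mulr2n lerD2l.
    by rewrite mulr_gt0 ?subr_gt0 // (le_lt_trans tU) // ltrDr (le_lt_trans t0).
  have -> : (r - t) * (r + t - U%:R) = r ^+ 2 - U%:R * r - (t ^+ 2 - U%:R * t) by ring.
  by rewrite t2 r2 [U%:R * t + _]addrC addrK -addrA -opprD subr_gt0.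
have cq : (c < q)%N.
  by rewrite -(@ltr_nat R); apply: le_lt_trans key; rewrite lerDr mulr_ge0.
split=> //; rewrite -(@ltr_nat R) natrM !natrX natrB 1?ltnW //.
have qc : 0 <= q%:R - c%:R :> R by rewrite subr_ge0 ler_nat ltnW.
have -> : U%:R ^+ 2 * q%:R = (U%:R * r) ^+ 2 by rewrite exprMn r2.
by rewrite ltr_pXn2r ?nnegrE ?mulr_ge0 // ltrBrDr.
Qed.

Lemma Q_bound_algC (R : rcfType) d m q : Q_bound R d m < q%:R ->
  (U_bound d m)%:R * sqrtC q%:R + (d ^ m.-1 * m)%:R < q%:R :> algC.
Proof.
move/Q_bound_nat => [cq Uq]; rewrite -ltrBrDr -natrB 1?ltnW //.
rewrite -(@ltr_pXn2r _ 2) ?nnegrE ?mulr_ge0 ?sqrtC_ge0 ?ler0n //.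
by rewrite exprMn sqrtCK -!natrX -natrM ltr_nat.
Qed.

Lemma sum_by_card m (g : nat -> nat) :
  (\sum_(A : {set 'I_m}) g #|A| = \sum_(k < m.+1) 'C(m, k) * g k)%N.
Proof.
have ltc (A : {set 'I_m}) : (#|A| < m.+1)%N.
  by rewrite ltnS -[X in (_ <= X)%N](card_ord m) max_card.
rewrite (partition_big (fun A : {set 'I_m} => Ordinal (ltc A)) xpredT) //=.
apply: eq_bigr => k _; rewrite (eq_bigr (fun=> g k)) => [|A /eqP <-] //.
rewrite sum_nat_const; congr (_ * _)%N.
rewrite -[X in 'C(X, _)](card_ord m) -card_draws -sum1_card -[RHS]sum1_card.
by apply: eq_bigl => A; rewrite [RHS]inE unfold_in.
Qed.

Lemma U_boundE d m : U_bound d m = (\sum_(A : {set 'I_m}) d.-1 ^ #|A| * #|A|.-1)%N.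
Proof.
rewrite (sum_by_card _ (fun k => d.-1 ^ k * k.-1)%N) /U_bound.
rewrite -(big_mkord xpredT (fun k => 'C(m, k) * (d.-1 ^ k * k.-1))%N).
rewrite [RHS]big_nat_recl // [LHS]big_add1 /= !muln0 add0n.
by apply: eq_bigr => k _; rewrite mulnA.
Qed.

(** If [v] is [chi (b - x)] divided by the required value, then
    [1 + v + ... + v^(e-1)] is [e] when the condition at [b] holds, and 0 when it
    fails with [x] distinct from [b].  Separating the term 1 matters: it makes
    the trivial character equal to 1 at 0 as well, and the number of factors
    actually present governs the Weil bound. *)

Section CyclotomicConditions.

Variables (F : finFieldType) (e : nat) (zeta : F) (z : algC).
Hypotheses (zeta_prim : e.-primitive_root zeta) (z_prim : e.-primitive_root z).
Hypotheses (e_gt0 : (0 < e)%N) (e_dvd : (e %| #|F|.-1)%N).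

Local Notation q := #|F|.
Local Notation chi := (mchar e zeta z).

Variables (m : nat) (b : 'I_m -> F) (k : 'I_m -> nat).
Hypothesis b_inj : injective b.

Let v (i : 'I_m) (x : F) : algC := chi (b i - x) * z^-1 ^+ k i.

Lemma test_eq0 (i : 'I_m) x : x != b i -> kappa e (b i - x) != zeta ^+ k i ->
  1 + \sum_(j < e.-1) v i x ^+ j.+1 = 0.
Proof.
move=> xb kx.
have bx : b i - x != 0 by rewrite subr_eq0 eq_sym.
have [l kl] := prim_rootP zeta_prim (kappa_exp e_dvd bx).
have vE : v i x = z ^+ l / z ^+ k i.
  by rewrite /v /mchar (negPf bx) kl (mu_isoE zeta_prim z_prim) exprVn.
have z0 : z != 0 by rewrite (prim_root_eq0 z_prim) -lt0n.
have v1 : v i x != 1.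
  rewrite vE; apply: contra_neq kx => /divr1_eq E; rewrite kl.
  by apply/eqP; rewrite (eq_prim_root_expr zeta_prim) -(eq_prim_root_expr z_prim) E.
have ve : v i x ^+ e = 1.
  by rewrite vE expr_div_n ![(z ^+ _) ^+ e]exprAC !(prim_expr_order z_prim) !expr1n divr1.
have -> : 1 + \sum_(j < e.-1) v i x ^+ j.+1 = \sum_(j < e) v i x ^+ j.
  rewrite -[RHS](big_mkord xpredT (fun j => v i x ^+ j)) -[in RHS](prednK e_gt0).
  by rewrite big_mkord big_ord_recl expr0.
apply/eqP; have : (v i x - 1) * \sum_(j < e) v i x ^+ j = 0 by rewrite -subrX1 ve subrr.
by move/eqP; rewrite mulf_eq0 subr_eq0 (negPf v1).
Qed.

Lemma test_norm (i : 'I_m) x : `|1 + \sum_(j < e.-1) v i x ^+ j.+1| <= e%:R.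
Proof.
have nv : `|v i x| <= 1.
  rewrite /v /mchar; case: eqP => [_|_]; first by rewrite mul0r normr0.
  have nz j : `|z ^+ j| = 1.
    have /eqP : `|z| ^+ e = 1 by rewrite -normrX (prim_expr_order z_prim) normr1.
    by rewrite pexpr_eq1 // normrX => /eqP ->; rewrite expr1n.
  by rewrite normrM exprVn normfV !nz invr1 mulr1.
apply: le_trans (ler_normD _ _) _; rewrite normr1 -[in leRHS](prednK e_gt0) -natr1 addrC
  lerD2r.
apply: le_trans (ler_norm_sum _ _ _) _.
apply: le_trans (_ : \sum_(j < e.-1) 1 <= _); last by rewrite sumr_const card_ord.
by apply: ler_sum => j _; rewrite normrX exprn_ile1.
Qed.

Lemma test_at_root (i : 'I_m) : 1 + \sum_(j < e.-1) v i (b i) ^+ j.+1 = 1.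
Proof.
rewrite big1 ?addr0 // => j _.
by rewrite /v subrr /mchar eqxx mul0r expr0n.
Qed.

Definition subset_sum (A : {set 'I_m}) : algC := \sum_x \prod_(i in A) \sum_(j < e.-1) v
  i x ^+ j.+1.

Lemma subset_sum_bound (A : {set 'I_m}) : A != set0 ->
  `|subset_sum A| <= (e.-1 ^ #|A| * #|A|.-1)%:R * sqrtC q%:R.
Proof.
move=> A0; have cA : (0 < #|A|)%N by rewrite card_gt0.
pose bA (i : 'I_#|A|) := b (enum_val i).
have bA_inj : injective bA by move=> i1 i2 /b_inj /enum_val_inj.
have -> : subset_sum A = \sum_(g : {ffun 'I_#|A| -> 'I_e.-1})
   (\prod_i (z^-1 ^+ k (enum_val i)) ^+ (g i).+1) *
   \sum_x \prod_i chi (bA i - x) ^+ (g i).+1.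
  rewrite /subset_sum.
  under eq_bigr => x _ do rewrite big_enum_val bigA_distr_bigA.
  rewrite exchange_big /=; apply: eq_bigr => g _; rewrite mulr_sumr; apply: eq_bigr => x
    _.
  by rewrite -big_split /=; apply: eq_bigr => i _; rewrite -exprMn mulrC.
apply: le_trans (ler_norm_sum _ _ _) _.
have nz j : `|z ^+ j| = 1.
  have /eqP : `|z| ^+ e = 1 by rewrite -normrX (prim_expr_order z_prim) normr1.
  by rewrite pexpr_eq1 // normrX => /eqP ->; rewrite expr1n.
apply: (@le_trans _ _ (\sum_(g : {ffun 'I_#|A| -> 'I_e.-1}) (#|A|.-1)%:R * sqrtC q%:R)).
  apply: ler_sum => g _; rewrite normrM normr_prod big1 ?mul1r; last first.
    by move=> i _; rewrite exprVn exprVn normfV -exprM nz invr1.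
  apply: weil_bound => // i; rewrite ltn0Sn /=.
  by have := ltn_ord (g i); rewrite -ltnS prednK.
by rewrite sumr_const card_ffun !card_ord natrM -mulrA [leRHS]mulr_natl.
Qed.

(** Expand the product of the tests over all [x] along subsets [A] of the
    conditions.  The empty subset contributes [q] and the others at most
    [U_bound e m * sqrt q]; but if no [x] met all conditions, only the points
    [b i] would contribute, each at most [e^(m-1)]. *)
Lemma cyclotomic_count :
    (U_bound e m)%:R * sqrtC q%:R + (e ^ m.-1 * m)%:R < q%:R :> algC ->
  exists x, forall i, kappa e (b i - x) = zeta ^+ k i.
Proof.
move=> hq.
case: (pickP (fun x => [forall i, kappa e (b i - x) == zeta ^+ k i])) => [x /forallP H|H].
  by exists x => i; apply/eqP.
pose T : algC := \sum_x \prod_i (1 + \sum_(j < e.-1) v i x ^+ j.+1).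
have TE : T = \sum_(A : {set 'I_m}) subset_sum A.
  rewrite /T exchange_big /=; apply: eq_bigr => x _.
  under eq_bigr => i _ do rewrite addrC.
  by rewrite bigA_distr /=; apply: eq_bigr => A _; rewrite -big_mkcond.
have S0 : subset_sum set0 = q%:R.
  rewrite /subset_sum; under eq_bigr => x _ do rewrite big_set0.
  by rewrite sumr_const.
have Tx x : `|\prod_i (1 + \sum_(j < e.-1) v i x ^+ j.+1)|
    <= \sum_i (if b i == x then (e ^ m.-1)%:R else 0).
  have s0 (P : pred 'I_m) : 0 <= \sum_(i | P i) (if b i == x then (e ^ m.-1)%:R else 0 :
    algC).
    by apply: sumr_ge0 => i _; case: ifP.
  case: (pickP (fun i => b i == x)) => [i /eqP bx|nb].
    rewrite [leRHS](bigD1 i) //= bx eqxx.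
    apply: (@le_trans _ _ (e ^ m.-1)%:R); last by rewrite lerDl.
    rewrite (bigD1 i) //= -bx test_at_root mul1r normr_prod.
    apply: (@le_trans _ _ (\prod_(i' < m | i' != i) e%:R)).
      by apply: ler_prod => i' _; rewrite normr_ge0 test_norm.
    by rewrite prodr_const -natrX; have := cardC1 i; rewrite card_ord => ->.
  have /negbT := H x; rewrite negb_forall => /existsP[i ki].
  by rewrite (bigD1 i) //= test_eq0 ?mul0r ?normr0 // eq_sym nb.
have Tle : `|T| <= (e ^ m.-1 * m)%:R.
  apply: le_trans (ler_norm_sum _ _ _) _.
  apply: le_trans (ler_sum _ (fun x _ => Tx x)) _.
  rewrite exchange_big /=.
  under eq_bigr => i _ do rewrite -big_mkcond (@big_pred1 _ _ _ _ (b i) _ _ (fun x =>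
    eq_sym (b i) x)).
  by rewrite sumr_const card_ord natrM mulr_natr.
have : q%:R <= `|T| + (U_bound e m)%:R * sqrtC q%:R.
  have qE : q%:R = T - \sum_(A : {set 'I_m} | A != set0) subset_sum A.
    by rewrite TE (bigD1 set0) //= addrK S0.
  rewrite -[leLHS]normr_nat [in leLHS]qE; apply: le_trans (ler_normB _ _) _.
  rewrite lerD2l; apply: le_trans (ler_norm_sum _ _ _) _.
  apply: le_trans (ler_sum _ (fun A A0 => subset_sum_bound A0)) _.
  rewrite -mulr_suml ler_wpM2r ?sqrtC_ge0 ?ler0n // -natr_sum ler_nat U_boundE.
  by rewrite [leqRHS](bigID (fun A : {set 'I_m} => A != set0)) /= leq_addr.
move/(fun H => le_trans H (lerD Tle (lexx _))); rewrite addrC => qle.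
by have := lt_le_trans hq qle; rewrite ltxx.
Qed.

End CyclotomicConditions.

(** Fewer than [m] conditions can be completed to exactly [m] by arbitrary ones. *)
Lemma cyclotomic_solution (R : rcfType) (F : finFieldType) e m (bs : seq (F * F)) :
    (0 < e)%N -> (e %| #|F|.-1)%N -> Q_bound R e m < #|F|%:R ->
    uniq (unzip1 bs) -> (size bs <= m)%N -> {in bs, forall p, p.2 ^+ e = 1} ->
  exists x, {in bs, forall p, kappa e (p.1 - x) = p.2}.
Proof.
move=> e0 eq hQ ub sb hb.
have [g gprim] := finField_prim_root F.
have zetaP := dvdn_prim_root gprim eq; set zeta := g ^+ _ in zetaP.
have [z zP] := C_prim_root_exists e0.
have [cq _] := Q_bound_nat hQ.
have mq : (m <= #|F|)%N.
  by apply: leq_trans (ltnW cq); rewrite leq_pmull // expn_gt0 e0.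
pose rest := [seq x <- enum F | x \notin unzip1 bs].
have PF : perm_eq (unzip1 bs ++ rest) (enum F).
  apply: uniq_perm; last by move=> x; rewrite mem_cat mem_filter mem_enum andbT orbN.
    rewrite cat_uniq ub filter_uniq ?enum_uniq // andbT /=.
    by apply/hasPn => x; rewrite mem_filter => /andP[].
  exact: enum_uniq.
pose s := take m (unzip1 bs ++ rest).
have us : uniq s by rewrite take_uniq // (perm_uniq PF) enum_uniq.
have ss : size s = m by rewrite size_takel // (perm_size PF) -cardE.
have bs_s x : x \in unzip1 bs -> x \in s.
  move=> xb; rewrite /s take_cat size_map; case: ltnP => [mb|_].
    by move: sb; rewrite leqNgt mb.
  by rewrite mem_cat xb.
(* The default 1 is itself an e-th root of unity, as required of the points
   added to reach m conditions. *)
pose bet x := nth 1 (unzip2 bs) (index x (unzip1 bs)).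
have bet1 x : bet x ^+ e = 1.
  rewrite /bet; have [lt|ge] := ltnP (index x (unzip1 bs)) (size (unzip2 bs)).
    have /mapP[p pb ->] := mem_nth 1 lt; exact: hb.
  by rewrite nth_default // expr1n.
have betE p : p \in bs -> bet p.1 = p.2.
  move=> pb; have ib : (index p bs < size bs)%N by rewrite index_mem.
  rewrite /bet -[in index _ _](nth_index p pb) -(nth_map p p.1) // index_uniq ?size_map
    //.
  by rewrite (nth_map p) // nth_index.
pose b (i : 'I_m) := nth 0 s i.
pose k (i : 'I_m) : nat := if [pick j : 'I_e | bet (b i) == zeta ^+ j] is Some j then j
  else 0%N.
have kE i : bet (b i) = zeta ^+ k i.
  rewrite /k; case: pickP => [j /eqP //|H].
  by have [j E] := prim_rootP zetaP (bet1 (b i)); have := H j; rewrite E eqxx.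
have b_inj : injective b.
  by move=> i j /eqP; rewrite nth_uniq ?ss // => /eqP /val_inj.
have [x Hx] := cyclotomic_count zetaP zP e0 eq k b_inj (Q_bound_algC hQ).
exists x => p pb.
have ps : p.1 \in s by apply/bs_s/map_f.
have im : (index p.1 s < m)%N by rewrite -ss index_mem.
have := Hx (Ordinal im); rewrite -kE /b /= nth_index // => ->.
exact: betE.
Qed.

(** * The Paley difference set *)

Lemma finField_two_neq0 (F : finFieldType) : odd #|F| -> 2 != 0 :> F.
Proof.
move=> oF; apply/negP => F2.
have c2 : 2%N \in [pchar F] by rewrite inE F2.
have := card_finField_pnat F; rewrite (eq_pnat _ (pcharf_eq c2)).
case/p_natP => l E; move: oF (finNzRing_gt1 F); rewrite E oddX orbF.
by case: l {E}.
Qed.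

Lemma eq_opp_eq0 (F : fieldType) (x : F) : 2 != 0 :> F -> x = - x -> x = 0.
Proof.
move=> F2 xx; apply/eqP; have : 2 * x == 0 by rewrite mulr_natl mulr2n {2}xx subrr.
by rewrite mulf_eq0 (negPf F2).
Qed.

Section PaleySet.

Variable F : finFieldType.
Local Notation p := #|F|.
Hypothesis p34 : p = 3 %[mod 4].

Definition half_order : nat := p.+1 %/ 2.
Local Notation e := half_order.

Lemma half_orderE : p = (e.*2).-1 /\ exists n, e = n.*2 /\ (0 < n)%N.
Proof.
rewrite /half_order; have [t pE] : exists t, p = (4 * t + 3)%N.
  by exists (p %/ 4)%N; rewrite {1}(divn_eq p 4) p34 mulnC.
rewrite pE; have -> : ((4 * t + 3).+1 %/ 2 = 2 * t + 2)%N by lia.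
by split; [|exists t.+1; split]; lia.
Qed.

Lemma half_order_double : e.*2 = p.+1.
Proof. by have [pE [n [eE n0]]] := half_orderE; rewrite pE eE; lia. Qed.

(** By Euler's criterion these are 0 and the nonzero squares, because
    [x^e = x * x^((p-1)/2)]. *)
Definition paley : {set F} := [set x | x ^+ e == x].

Lemma card_odd : odd p.
Proof. by have [-> [n [-> n0]]] := half_orderE; lia. Qed.

Let F2 : 2 != 0 :> F. Proof. exact: finField_two_neq0 card_odd. Qed.

Lemma paleyM x y : x \in paley -> y \in paley -> x * y \in paley.
Proof. by rewrite !inE exprMn => /eqP -> /eqP ->. Qed.

Lemma paleyV x : x \in paley -> x^-1 \in paley.
Proof. by rewrite !inE exprVn => /eqP ->. Qed.

Lemma paley0 : 0 \in paley.
Proof. by rewrite inE expr0n; have [_ [n [-> n0]]] := half_orderE; case: n n0. Qed.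

Lemma paley_total x : (x \in paley) || (- x \in paley).
Proof.
have [pE [n [eE n0]]] := half_orderE; rewrite !inE.
have [->|x0] := eqVneq x 0; first by rewrite oppr0 orbb; have := paley0; rewrite inE.
have -> : (- x) ^+ e = x ^+ e by rewrite eE -mul2n !exprM sqrrN.
by rewrite -eqf_sqr -exprM muln2 half_order_double exprS expf_card.
Qed.

Lemma paley_excl x : x \in paley -> - x \in paley -> x = 0.
Proof.
have [pE [n [eE n0]]] := half_orderE; rewrite !inE => /eqP xe.
have -> : (- x) ^+ e = x ^+ e by rewrite eE -mul2n !exprM sqrrN.
by rewrite xe => /eqP; apply: eq_opp_eq0.
Qed.

Lemma card_paley : #|paley| = e.
Proof.
have [pE [n [eE n0]]] := half_orderE.
have U : paley :|: [set - x | x in paley] = setT.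
  apply/setP => x; rewrite !inE; have := paley_total x; rewrite !inE => /orP[->//|nx].
  by apply/orP; right; apply/imsetP; exists (- x); rewrite ?opprK ?inE.
have I : paley :&: [set - x | x in paley] = [set 0].
  apply/setP => x; rewrite in_setI in_set1; apply/andP/eqP => [[xp /imsetP[y yp E]]|->].
    by apply: paley_excl => //; rewrite E opprK.
  by rewrite paley0; split=> //; apply/imsetP; exists 0; rewrite ?paley0 ?oppr0.
have := cardsUI paley [set - x | x in paley].
rewrite U I cardsT cards1 card_imset; last exact: oppr_inj.
by rewrite addn1 -half_order_double addnn => /double_inj.
Qed.

Definition diff_pairs v : {set F * F} := [set u in setX paley paley | u.1 - u.2 == v].
Local Notation unit_pairs := (diff_pairs 1%R).

Lemma mem_diff_pairs v s t :
  ((s, t) \in diff_pairs v) = [&& s \in paley, t \in paley & s - t == v].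
Proof. by rewrite !inE /= andbA. Qed.

(** Multiplication by a nonzero square preserves [paley], and every nonzero [v] is
    a square up to sign; so no difference occurs more often than 1. *)
Lemma fiber_paley v : v != 0 ->
  (#|diff_pairs v| <= #|unit_pairs|)%N.
Proof.
move=> v0; case/orP: (paley_total v) => vp.
  pose g (u : F * F) := (v^-1 * u.1, v^-1 * u.2).
  have gi : injective g.
    by move=> [u1 u2] [w1 w2] [/(mulfI (invr_neq0 v0)) -> /(mulfI (invr_neq0 v0)) ->].
  rewrite -(card_imset _ gi) subset_leq_card //; apply/subsetP => _ /imsetP[[s t] + ->].
  rewrite /g /= !mem_diff_pairs => /and3P[u1 u2 /eqP uv].
  by rewrite !paleyM ?paleyV //= -mulrBr uv mulVf.
pose g (u : F * F) := (- v^-1 * u.2, - v^-1 * u.1).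
have nv0 : - v^-1 != 0 by rewrite oppr_eq0 invr_eq0.
have gi : injective g.
  by move=> [u1 u2] [w1 w2] [/(mulfI nv0) -> /(mulfI nv0) ->].
rewrite -(card_imset _ gi) subset_leq_card //; apply/subsetP => _ /imsetP[[s t] + ->].
rewrite /g /= !mem_diff_pairs => /and3P[u1 u2 /eqP uv].
rewrite -invrN !paleyM ?paleyV //= -mulrBr -(opprB s) uv invrN mulNr mulrN opprK.
by rewrite mulVf.
Qed.

(** The [e (e - 1)] ordered pairs of distinct elements have [2 (e - 1)] possible
    differences, none occurring more often than 1. *)
Lemma card_unit_pairs : (e <= (#|unit_pairs|).*2)%N.
Proof.
have [pE [n [eE n0]]] := half_orderE.
have cX : #|setX paley paley| = (e * e)%N by rewrite cardsX card_paley.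
have part : (#|setX paley paley| = \sum_v #|diff_pairs v|)%N.
  rewrite -sum1_card (partition_big (fun u => u.1 - u.2) xpredT) //=.
  apply: eq_bigr => v _; rewrite -sum1_card; apply: eq_bigl => u.
  by rewrite [RHS]inE.
have d0 : (#|diff_pairs 0%R| <= e)%N.
  rewrite -card_paley -(card_imset _ (_ : injective (fun s : F => (s, s)))); last by
    move=> s t [].
  apply/subset_leq_card/subsetP => -[s t]; rewrite !inE /= subr_eq0 => /andP[/andP[sp _]
    /eqP <-].
  by apply/imsetP; exists s; rewrite ?inE.
have rest : (\sum_(v | v != 0%R) #|diff_pairs v|
    <= p.-1 * #|unit_pairs|)%N.
  rewrite -[X in (X * _)%N](cardC1 (0 : F)) -sum_nat_const.
  by apply: leq_sum => v v0; apply: fiber_paley.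
move: part; rewrite cX (bigD1 0) //= => part.
have : (e * e <= e + p.-1 * #|unit_pairs|)%N by rewrite part leq_add.
have -> : p.-1 = (2 * e.-1)%N by rewrite pE; lia.
have e1 : (0 < e.-1)%N by rewrite eE; lia.
move=> H; rewrite -(leq_pmul2l e1) -muln2 -{2}[e]mul1n.
have -> : (e.-1 * (1 * e) = e * e - e)%N by rewrite mul1n -subn1 mulnBl mul1n.
by rewrite leq_subLR; apply: leq_trans H _; rewrite leq_add2l [(2 * _)%N]mulnC -mulnA [(2
  * _)%N]mulnC.
Qed.

End PaleySet.

(** * Greedy choice of the second coordinates *)

Section KappaSign.

Variables (F : finFieldType) (e : nat).
Hypotheses (e_gt0 : (0 < e)%N) (e_dvd : (2 * e %| #|F|.-1)%N).

Lemma half_dvd : (e %| #|F|.-1)%N.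
Proof. by apply: dvdn_trans e_dvd; rewrite dvdn_mull. Qed.

Lemma card_pred_gt0 : (0 < #|F|.-1)%N.
Proof. by have := finNzRing_gt1 F; case: #|F| => [|[|]]. Qed.

Lemma odd_card : odd #|F|.
Proof.
have /dvdnP[t E] := e_dvd; have := finNzRing_gt1 F.
case: #|F| E => // n /= ->; lia.
Qed.

Lemma kappaN1 : kappa e (-1 : F) = 1.
Proof.
rewrite /kappa; have /dvdnP[t ->] := e_dvd.
by rewrite mulnA mulnK // mulnC exprM sqrrN !expr1n.
Qed.

Lemma kappaN (x : F) : kappa e (- x) = kappa e x.
Proof. by rewrite -mulN1r kappaM kappaN1 mul1r. Qed.

Lemma kappa0 : kappa e (0 : F) = 0.
Proof.
by rewrite /kappa expr0n eqn0Ngt divn_gt0 // dvdn_leq ?half_dvd ?card_pred_gt0.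
Qed.

Lemma kappaV (x : F) : kappa e x^-1 = (kappa e x)^-1.
Proof. by rewrite /kappa exprVn. Qed.

Lemma kappa_eq1_neq0 (x : F) : kappa e x = 1 -> x != 0.
Proof. by apply: contra_eq_neq => ->; rewrite kappa0 eq_sym oner_neq0. Qed.

(** One element of each pair [x], [- x] in the kernel of [kappa]; the choice is
    made by an arbitrary enumeration of the field. *)
Definition half_kernel : {set F} :=
  [set x | (kappa e x == 1) && (enum_rank x < enum_rank (- x)%R)%N].

Lemma half_kernel_total (x : F) : kappa e x = 1 -> (x \in half_kernel) || (- x \in
  half_kernel).
Proof.
move=> kx; rewrite !inE kappaN kx eqxx /= opprK; case: ltngtP => // /val_inj
  /enum_rank_inj E.
have := kappa_eq1_neq0 kx.
by rewrite (eq_opp_eq0 (finField_two_neq0 odd_card) E) eqxx.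
Qed.

Lemma half_kernel_neq0 (x : F) : x \in half_kernel -> x != 0.
Proof. by rewrite inE => /andP[/eqP kx _]; apply: kappa_eq1_neq0. Qed.

Lemma card_half_kernel : (#|half_kernel| * (2 * e) <= #|F|.-1)%N.
Proof.
pose n := (#|F|.-1 %/ e)%N.
have n0 : (0 < n)%N by rewrite divn_gt0 // dvdn_leq ?half_dvd ?card_pred_gt0.
have cU : #|half_kernel :|: [set - x | x in half_kernel]| = (2 * #|half_kernel|)%N.
  rewrite cardsU card_imset; last exact: oppr_inj.
  rewrite (_ : _ :&: _ = set0) ?cards0 ?subn0 ?mul2n ?addnn //.
  apply/setP => x; rewrite in_setI in_set0; apply/negP => /andP[xh /imsetP[y yh E]].
  move: xh yh; rewrite E !inE opprK => /andP[_ l1] /andP[_ l2].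
  by have := ltn_trans l1 l2; rewrite ltnn.
(* The kernel of kappa is contained in the n-th roots of unity. *)
have le : (2 * #|half_kernel| <= n)%N.
  rewrite -cU cardE; apply: max_unity_roots n0 _ (enum_uniq _).
  apply/allP => x; rewrite mem_enum in_setU unity_rootE => /orP[|/imsetP[y + ->]].
    by rewrite inE => /andP[].
  by rewrite inE -/(kappa e (- y)) kappaN => /andP[].
by rewrite mulnA [(_ * 2)%N]mulnC -leq_divRL.
Qed.

End KappaSign.

(** Each new value [x] must satisfy [kappa x = cl i], [kappa (y j - x) = cminus]
    and [kappa (- y j - x) = cplus] for the earlier [j]: at most [2 e - 1]
    conditions.  They sit at distinct points, as the classes [cl j] differ and
    are unchanged by a sign. *)

Section Greedy.

Variables (R : rcfType) (F : finFieldType) (e : nat).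
Hypotheses (e_gt0 : (0 < e)%N) (e_dvd : (2 * e %| #|F|.-1)%N).
Hypothesis hQ : Q_bound R e (2 * e).-1 < #|F|%:R.
Variables (I : eqType) (cl : I -> F) (cminus cplus : I -> I -> F).
Hypotheses (cl1 : forall i, cl i ^+ e = 1) (cminus1 : forall i j, cminus i j ^+ e = 1).
Hypothesis cplus1 : forall i j, cplus i j ^+ e = 1.

Lemma greedy_choice (s : seq I) :
    uniq s -> (size s <= e)%N -> {in s &, injective cl} ->
    {in s &, forall i j, i != j -> cminus i j = cminus j i /\ cplus i j = cplus j i} ->
  exists y : I -> F, {in s, forall i, kappa e (y i) = cl i} /\
    {in s &, forall i j, i != j ->
      kappa e (y i - y j) = cminus i j /\ kappa e (y i + y j) = cplus i j}.
Proof.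
elim: s => [|i0 s IH] /=; first by move=> _ _ _ _; exists (fun=> 0); split.
case/andP=> i0s us ss inj sym.
have sub i : i \in s -> i \in i0 :: s by rewrite inE orbC => ->.
have [|i j is_ js|i j is_ js|y [ycl ypair]] := IH us.
- exact: ltnW.
- by apply: inj; apply: sub.
- by apply: sym; apply: sub.
have y0 i : i \in s -> y i != 0.
  move=> is_; apply: contra_eq_neq (cl1 i) => yi.
  by rewrite -(ycl i is_) yi (kappa0 e_gt0 e_dvd) expr0n eqn0Ngt e_gt0 eq_sym oner_neq0.
have F2 := finField_two_neq0 (odd_card e_gt0 e_dvd).
(* The point 0 carries the condition on kappa x itself, as kappa (- x) = kappa x. *)
pose bs := (0, cl i0) :: [seq (y i, cminus i0 i) | i <- s] ++ [seq (- y i, cplus i0 i) |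
  i <- s].
have ub : uniq (unzip1 bs).
  rewrite /bs /= /unzip1 map_cat -!map_comp mem_cat cat_uniq.
  apply/and4P; split.
  - apply/norP; split; apply/negP => /mapP[i is_ /= /eqP]; rewrite eq_sym ?oppr_eq0
    (negPf (y0 i is_)) //.
  - rewrite map_inj_in_uniq // => i j is_ js /= E.
    by apply: inj; rewrite ?sub // -!ycl // E.
  - apply/hasPn => _ /mapP[i is_ ->] /=; apply/negP => /mapP[j js /= E].
    have ij : i = j.
      by apply: inj; rewrite ?sub // -!ycl // -E (kappaN e_gt0 e_dvd).
    have := y0 i is_; rewrite (@eq_opp_eq0 _ (y i) F2) ?eqxx //.
    by rewrite E ij.
  - rewrite map_inj_in_uniq // => i j is_ js /= /oppr_inj E.
    by apply: inj; rewrite ?sub // -!ycl // E.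
have sb : (size bs <= (2 * e).-1)%N.
  by rewrite /bs /= size_cat !size_map; lia.
have hb : {in bs, forall p, p.2 ^+ e = 1}.
  move=> p; rewrite inE mem_cat => /or3P[/eqP ->|/mapP[i _ ->]|/mapP[i _ ->]];
    by rewrite /= ?cl1 ?cminus1 ?cplus1.
have [x Hx] := cyclotomic_solution e_gt0 (half_dvd e_dvd) hQ ub sb hb.
have x0 : kappa e x = cl i0.
  by have := Hx (0, cl i0) (mem_head _ _); rewrite /= sub0r (kappaN e_gt0 e_dvd).
have xm i : i \in s -> kappa e (y i - x) = cminus i0 i.
  move=> is_; apply: (Hx (y i, cminus i0 i)); rewrite inE mem_cat; apply/or3P; apply:
    Or32.
  by apply/mapP; exists i.
have xp i : i \in s -> kappa e (y i + x) = cplus i0 i.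
  move=> is_; have := Hx (- y i, cplus i0 i); rewrite /= -opprD (kappaN e_gt0 e_dvd);
    apply.
  by rewrite inE mem_cat; apply/or3P; apply: Or33; apply/mapP; exists i.
exists (fun i => if i == i0 then x else y i); split.
  move=> i; rewrite inE; case: eqP => [-> //|_ /= is_]; exact: ycl.
have ne i : i \in s -> i == i0 = false by move=> is_; apply/negP => /eqP E; rewrite E
  (negPf i0s) in is_.
move=> i j ii jj ij; have [sm sp] := sym i j ii jj ij.
move: ii jj ij sm sp; rewrite !inE => /orP[/eqP ->|is_] /orP[/eqP ->|js]; rewrite ?eqxx
  // => ij sm sp.
- by rewrite (ne j js) -(kappaN e_gt0 e_dvd) opprB xm // addrC xp.
- by rewrite (ne i is_) xm // xp.
- by rewrite (ne i is_) (ne j js); apply: ypair.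
Qed.

End Greedy.

(** * The frame difference family *)

(** The multiset equalities are obtained by counting: every element of the target
    occurs, and the list is too short to contain repetitions. *)
Lemma perm_eq_of_cover (T : eqType) (s1 s2 : seq T) :
  uniq s1 -> {subset s1 <= s2} -> (size s2 <= size s1)%N -> perm_eq s2 s1.
Proof.
move=> u1 sub sz; have [szE memE] := uniq_min_size u1 sub sz.
rewrite perm_sym; apply: uniq_perm => //.
by rewrite (leq_size_uniq u1 sub sz).
Qed.

(** The hypotheses on [y] are the cyclotomic conditions of the construction:
    [y] represents every class on [paley], and for every nonzero [v] in [paley]
    the sums and differences [y s + y t], [y s - y t] with [s - t = v] do too.
    Since [- v] gives the opposite values, all differences are covered. *)

Section Construction.

Variables (P F : finFieldType).
Local Notation p := #|P|.
Local Notation q := #|F|.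
Hypothesis p34 : p = 3 %[mod 4].
Local Notation e := (half_order P).
Local Notation D := (paley P).
Hypothesis e_dvd : (2 * e %| q.-1)%N.

Variable y : P -> F.
Hypothesis y_neq0 : forall s, s \in D -> y s != 0.
Hypothesis y_cover : forall z : F, z != 0 -> exists2 s, s \in D & kappa e z = kappa e (y
  s).
Hypothesis pair_cover : forall (v : P) (z : F), v \in D -> v != 0 -> z != 0 ->
  exists s t, [/\ s \in D, t \in D & s - t = v] /\
    (kappa e z = kappa e (y s - y t) \/ kappa e z = kappa e (y s + y t)).

Local Notation V := (P * F)%type.
Let N : {set V} := setX [set: P] [set 0].
Let S := half_kernel F e.

Let e_gt0 : (0 < e)%N.
Proof. by have [_ [n [-> n0]]] := half_orderE p34; lia. Qed.

Let two_e : (2 * e = p.+1)%N.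
Proof. by rewrite mul2n half_order_double. Qed.

Let F2 : 2 != 0 :> F. Proof. exact: finField_two_neq0 (odd_card e_gt0 e_dvd). Qed.

Definition block_elt (t : F) (c : P * bool) : V := (c.1, if c.2 then t * y c.1 else - (t
  * y c.1)).
Definition block (t : F) : {set V} := block_elt t @: setX D [set: bool].
Definition blocks : seq {set V} := [seq block t | t <- enum S].

Lemma block_elt_inj t : t != 0 -> {in setX D [set: bool] &, injective (block_elt t)}.
Proof.
move=> t0 [s a] [s' a']; rewrite !inE /= !andbT => sD s'D [ss]; rewrite -ss.
have ty : t * y s != 0 by rewrite mulf_neq0 // y_neq0 // inE.
case: a; case: a' => //= E; move: ty.
  by rewrite (eq_opp_eq0 F2 E) eqxx.
by rewrite (eq_opp_eq0 F2 (esym E)) eqxx.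
Qed.

Lemma card_block t : t != 0 -> #|block t| = p.+1.
Proof.
move=> t0; rewrite (card_in_imset (block_elt_inj t0)) cardsX cardsT card_bool card_paley
  //.
by rewrite mulnC.
Qed.

Lemma mem_block t s (a : bool) : s \in D ->
  (s, if a then t * y s else - (t * y s)) \in block t.
Proof. by move=> sD; apply/imsetP; exists (s, a); rewrite // in_setX sD in_setT. Qed.

Lemma kernel_split (z w : F) : z != 0 -> kappa e z = kappa e w ->
  exists t, t \in S /\ (z = t * w \/ z = - (t * w)).
Proof.
move=> z0 zw; have w0 : w != 0.
  apply: contra_neq z0 => w0; apply/eqP; move: zw; rewrite w0 (kappa0 e_gt0 e_dvd) =>
    /eqP.
  by rewrite /kappa expf_eq0 => /andP[].
have k1 : kappa e (z / w) = 1.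
  rewrite kappaM kappaV zw mulfV // -zw /kappa expf_neq0 //.
case/orP: (half_kernel_total e_gt0 e_dvd k1) => zS.
  by exists (z / w); split=> //; left; rewrite divfK.
by exists (- (z / w)); split=> //; right; rewrite mulNr opprK divfK.
Qed.

Lemma card_setN : #|N| = p.
Proof. by rewrite cardsX cardsT cards1 muln1. Qed.

Lemma card_setCN : #|~: N| = (p * q.-1)%N.
Proof.
have := cardsC N; rewrite card_setN card_prod => E.
by rewrite -subn1 mulnBr muln1 -E addKn.
Qed.

Lemma card_S : (#|S| * p.+1 <= q.-1)%N.
Proof. by rewrite -two_e; apply: card_half_kernel. Qed.

Lemma mem_N u : (u \in N) = (u.2 == 0).
Proof. by case: u => a z; rewrite in_setX !inE. Qed.

Lemma blocks_is_DF : is_DF N p.+1 1 blocks.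
Proof.
split.
- split; first by rewrite mem_N.
  by move=> u w; rewrite !mem_N /= => /eqP -> /eqP ->; rewrite subrr.
- by move=> _ /mapP[t + ->]; rewrite mem_enum => tS; apply: card_block (half_kernel_neq0
  e_gt0 e_dvd tS).
rewrite /= cats0; apply: perm_eq_of_cover; first exact: enum_uniq.
  move=> [d z]; rewrite mem_enum in_setC mem_N /= => z0.
  suff [t [s [a [s' [a' [tS sD s'D dE zE]]]]]] : exists t s (a : bool) s' (a' : bool),
      [/\ t \in S, s \in D, s' \in D, d = s - s' & z = (if a then t * y s else - (t * y
        s))
        - (if a' then t * y s' else - (t * y s'))].
    apply/flattenP; exists (block_differences (block t)).
      by apply/map_f/map_f; rewrite mem_enum.
    pose x : V := (s, if a then t * y s else - (t * y s)).
    pose x' : V := (s', if a' then t * y s' else - (t * y s')).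
    have E : (d, z) = x - x' by rewrite dE zE.
    apply/allpairsPdep; exists x, x'; rewrite !mem_enum in_setD1 !mem_block // andbT;
      split=> //.
    by apply: contra_neq z0 => xx; move: E; rewrite xx subrr => -[].
  have [d0|d0] := eqVneq d 0.
    have z2 : z / 2 != 0 by rewrite mulf_neq0 ?invr_eq0.
    have [s sD kz] := y_cover z2.
    have [t [tS zt]] := kernel_split z2 kz.
    have zE : z = z / 2 + z / 2 by rewrite -mulr2n -[RHS]mulr_natr divfK.
    case: zt => zt; rewrite zE zt.
      exists t, s, true, s, false; split=> //; first by rewrite subrr.
      by rewrite opprK.
    by exists t, s, false, s, true; split=> //; rewrite subrr.
  case/orP: (paley_total p34 d) => dD.
    have [s [s' [[sD s'D ss'] [kz|kz]]]] := pair_cover dD d0 z0.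
      have [t [tS [zt|zt]]] := kernel_split z0 kz; rewrite zt.
        by exists t, s, true, s', true; split=> //=; ring.
      by exists t, s, false, s', false; split=> //=; ring.
    have [t [tS [zt|zt]]] := kernel_split z0 kz; rewrite zt.
      by exists t, s, true, s', false; split=> //=; ring.
    by exists t, s, false, s', true; split=> //=; ring.
  have nd0 : - d != 0 by rewrite oppr_eq0.
  have [s [s' [[sD s'D ss'] kz]]] := pair_cover dD nd0 z0.
  have dE : d = s' - s by rewrite -(opprB s) ss' opprK.
  case: kz => kz.
    have [t [tS [zt|zt]]] := kernel_split z0 kz; rewrite zt.
      by exists t, s', false, s, false; split=> //=; ring.
    by exists t, s', true, s, true; split=> //=; ring.
  have [t [tS [zt|zt]]] := kernel_split z0 kz; rewrite zt.
    by exists t, s', true, s, false; split=> //=; ring.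
  by exists t, s', false, s, true; split=> //=; ring.
rewrite size_flatten /shape -map_comp sumnE big_map.
rewrite -cardE card_setCN; apply: leq_trans (_ : #|S| * (p.+1 * p) <= _)%N; last first.
  by rewrite mulnA mulnC leq_mul2l card_S orbT.
rewrite /blocks big_map big_seq.
rewrite (eq_bigr (fun=> (p.+1 * p)%N)) => [|t tS].
  by rewrite -big_seq big_const_seq count_predT iter_addn_0 -cardE mulnC.
rewrite mem_enum in tS; have ct := card_block (half_kernel_neq0 e_gt0 e_dvd tS).
rewrite /= /block_differences size_allpairs_dep sumnE big_map big_seq.
rewrite (eq_bigr (fun=> p)) => [|x xB].
  by rewrite -big_seq big_const_seq count_predT iter_addn_0 -cardE ct mulnC.
rewrite mem_enum in xB; rewrite -cardE.
by have := cardsD1 x (block t); rewrite xB ct add1n => -[].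
Qed.

Lemma add_coset_setN (x : V) : add_coset N x = [set w | w.2 == x.2].
Proof.
apply/setP => w; rewrite inE; apply/imsetP/eqP => [[u + ->]|wx].
  by rewrite mem_N => /eqP /= ->; rewrite addr0.
exists (w - x); last by rewrite addrC subrK.
by rewrite mem_N /= wx subrr.
Qed.

Lemma blocks_representatives :
  nontrivial_coset_representatives N (flatten [seq enum B | B : {set V} <- blocks])
  /\ (#|S| * p.+1 = q.-1)%N.
Proof.
set L := flatten _.
have szL : size [seq add_coset N x | x <- L] = (#|S| * p.+1)%N.
  rewrite size_map /L size_flatten /shape -map_comp sumnE big_map /blocks big_map big_seq.
  rewrite (eq_bigr (fun=> p.+1)) => [|t]; last first.
    by rewrite mem_enum => tS; rewrite /= -cardE (card_block (half_kernel_neq0 e_gt0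
      e_dvd tS)).
  by rewrite -big_seq big_const_seq count_predT iter_addn_0 -cardE mulnC.
have sub : {subset enum (nontrivial_cosets N) <= [seq add_coset N x | x <- L]}.
  move=> C; rewrite mem_enum in_setD1 => /andP[CN /imsetP[x _ CE]].
  have z0 : x.2 != 0.
    apply: contra_neq CN => x2; rewrite CE add_coset_setN; apply/setP => w.
    by rewrite mem_N inE x2.
  have [s sD kz] := y_cover z0; have [t [tS zt]] := kernel_split z0 kz.
  apply/mapP; exists (s, x.2); last by rewrite CE !add_coset_setN.
  apply/flattenP; exists (enum (block t)); first by apply/map_f/map_f; rewrite mem_enum.
  by rewrite mem_enum; case: zt => ->; [exact: (mem_block t true) | exact: (mem_block t
    false)].
have card_cosets : (q.-1 <= #|nontrivial_cosets N|)%N.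
  pose cos (z : F) : {set V} := [set w | w.2 == z].
  have ci : injective cos.
    by move=> z1 z2 /setP /(_ (0, z1)); rewrite !inE /= eqxx => /esym/eqP.
  rewrite -(cardC1 (0 : F)) -(card_imset _ ci) subset_leq_card //.
  apply/subsetP => _ /imsetP[z z0 ->]; rewrite in_setD1; apply/andP; split.
    apply: contraTneq z0 => /setP /(_ (0, z)).
    by rewrite mem_N /cos in_set /= eqxx => /esym zz; rewrite !inE zz.
  by apply/imsetP; exists (0, z); rewrite ?inE // add_coset_setN.
have szle : (size [seq add_coset N x | x <- L] <= size (enum (nontrivial_cosets N)))%N.
  by rewrite szL -cardE; apply: leq_trans card_S card_cosets.
have PE : perm_eq [seq add_coset N x | x <- L] (enum (nontrivial_cosets N)).
  exact: perm_eq_of_cover (enum_uniq _) sub szle.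
split=> //; apply/eqP; rewrite eqn_leq card_S -szL (perm_size PE) -cardE.
exact: card_cosets.
Qed.

Lemma blocks_elementary_FDF : is_elementary_FDF N p.+1 1 blocks.
Proof.
have [reps cS] := blocks_representatives.
split; last by rewrite card_setN mul1n subn1.
split; first exact: blocks_is_DF.
exists [:: blocks]; split; first by rewrite /= cats0.
  by rewrite card_setN subn1.
move=> _ /[1!inE] /eqP ->; split=> //.
rewrite size_map -cardE card_setN card_prod mulnCA cS.
by rewrite -subn1 mulnBr muln1.
Qed.

End Construction.

(** The pairs in [paley] with difference [v] are obtained by scaling from those
    with difference 1; numbering the latter by [j], the sum and the difference
    of the values at a pair are given the classes [2 j] and [2 j + 1].  There
    are enough pairs to reach all [e] classes. *)
Lemma paley_choice (R : rcfType) (P F : finFieldType) (e := half_order P) :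
    #|P| = 3 %[mod 4] -> (2 * e %| #|F|.-1)%N -> Q_bound R e #|P| < #|F|%:R ->
  exists y : P -> F,
    [/\ forall s, s \in paley P -> y s != 0,
        forall z : F, z != 0 -> exists2 s, s \in paley P & kappa e z = kappa e (y s)
      & forall (v : P) (z : F), v \in paley P -> v != 0 -> z != 0 ->
          exists s t, [/\ s \in paley P, t \in paley P & s - t = v] /\
          (kappa e z = kappa e (y s - y t) \/ kappa e z = kappa e (y s + y t))].
Proof.
move=> p34 edvd hQ.
have e0 : (0 < e)%N by have [_ [n [E n0]]] := half_orderE p34; rewrite /e E; lia.
have ed := half_dvd edvd.
have [g gprim] := finField_prim_root F.
have zetaP := dvdn_prim_root gprim ed; set zeta := g ^+ _ in zetaP.
pose sD := enum (paley P); pose sU := enum (diff_pairs (1 : P)).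
have szD : size sD = e by rewrite -cardE card_paley.
have szU : (e <= (size sU).*2)%N by rewrite -cardE; apply: card_unit_pairs.
(* The pair is oriented so that its difference lies in paley, then scaled. *)
pose idx (s t : P) := if s - t \in paley P then index ((s - t)^-1 * s, (s - t)^-1 * t) sU
                      else index ((t - s)^-1 * t, (t - s)^-1 * s) sU.
have idxC s t : s != t -> idx s t = idx t s.
  move=> st; rewrite /idx; case: ifP => st1; case: ifP => ts1 //.
    have := paley_excl p34 st1; rewrite opprB => /(_ ts1) /eqP.
    by rewrite subr_eq0 (negPf st).
  by have := paley_total p34 (s - t); rewrite opprB st1 ts1.
pose cl (s : P) : F := zeta ^+ index s sD.
pose cminus (s t : P) : F := zeta ^+ (idx s t).*2.
pose cplus (s t : P) : F := zeta ^+ (idx s t).*2.+1.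
have z1 j : (zeta ^+ j) ^+ e = 1 by rewrite exprAC (prim_expr_order zetaP) expr1n.
have hQ' : Q_bound R e (2 * e).-1 < #|F|%:R by rewrite mul2n half_order_double.
have cl_inj : {in sD &, injective cl}.
  move=> s t ss ts /eqP; rewrite (eq_prim_root_expr zetaP) !modn_small -?szD ?index_mem
    // => /eqP E.
  by rewrite -(nth_index 0 ss) E nth_index.
have sym : {in sD &, forall i j, i != j -> cminus i j = cminus j i /\ cplus i j = cplus j
  i}.
  by move=> i j _ _ ij; rewrite /cminus /cplus idxC.
have [y [ycl ypair]] := greedy_choice e0 edvd hQ' (fun i => z1 _) (fun i j => z1 _)
  (fun i j => z1 _) (enum_uniq _) (eq_leq szD) cl_inj sym.
exists y; split.
- move=> s sp; apply: contra_eq_neq (z1 (index s sD)) => ys.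
  rewrite -[zeta ^+ _](ycl s) ?mem_enum // ys (kappa0 e0 edvd) expr0n eqn0Ngt e0.
  by rewrite eq_sym oner_neq0.
- move=> z z0; have [k ->] := prim_rootP zetaP (kappa_exp ed z0).
  have kD : (k < size sD)%N by rewrite szD.
  have sk : nth 0 sD k \in sD by apply: mem_nth.
  exists (nth 0 sD k); first by rewrite -mem_enum.
  by rewrite (ycl _ sk) /cl index_uniq ?enum_uniq.
move=> v z vD v0 z0; have [k kz] := prim_rootP zetaP (kappa_exp ed z0).
have jU : (k./2 < size sU)%N.
  by rewrite -ltn_double (leq_trans _ szU) // (leq_ltn_trans _ (ltn_ord k)) //
    -[leqRHS]odd_double_half leq_addl.
case E1: (nth (0, 0) sU k./2) => [s1 t1].
have : (s1, t1) \in sU by rewrite -E1 mem_nth.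
rewrite mem_enum mem_diff_pairs => /and3P[s1P t1P /eqP st1].
have vst : v * s1 - v * t1 = v by rewrite -mulrBr st1 mulr1.
have idxE : idx (v * s1) (v * t1) = k./2.
  by rewrite /idx vst vD !mulKf // -E1 index_uniq ?enum_uniq.
have vsD : v * s1 \in sD by rewrite mem_enum paleyM.
have vtD : v * t1 \in sD by rewrite mem_enum paleyM.
have st_ne : v * s1 != v * t1 by rewrite -subr_eq0 vst.
exists (v * s1), (v * t1); split; first by rewrite !paleyM.
have [-> ->] := ypair _ _ vsD vtD st_ne.
rewrite /cminus /cplus idxE kz -{1 3}(odd_double_half k).
by case: (odd k); [right | left].
Qed.

Theorem theorem4p5 (R : rcfType) (p q : nat) (Fp Fq : finFieldType)
    (hp : prime_power p) (hp34 : p = 3 %[mod 4]) (hFp : #|Fp| = p)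
    (hq : prime_power q) (hq1 : q = 1 %[mod p.+1]) (hFq : #|Fq| = q)
    (hQ : Q_bound R (p.+1 %/ 2) p < q%:R) :
  exists Bs : seq {set Fp * Fq},
    is_elementary_FDF (setX [set: Fp] [set (0 : Fq)]) p.+1 1 Bs.
Proof.
subst p q.
have e_dvd : (2 * half_order Fp %| #|Fq|.-1)%N.
  rewrite mul2n half_order_double // -subn1 -eqn_mod_dvd; first exact/eqP.
  exact: ltnW (finNzRing_gt1 Fq).
have [y [y0 ycover ypair]] := paley_choice hp34 e_dvd hQ.
by exists (blocks y); apply: blocks_elementary_FDF.
Qed.
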